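(* Let $m\ge2$ and $1\le k\le 8$, and let $p_{3k}(n)$, $\nu=\nu_m(k)$ and $c_2$ be as defined in the context. The following hold: (i) If $c_2^\beta\not\equiv0\pmod m$ for every $\beta\ge1$, then for all $\beta\ge 1$, $n\ge0$ and $i\in\{1,2\}$, $$p_{3k}\left(3^{2\nu\beta}n+\frac{(3k+8i)\cdot3^{2\nu\beta-1}-k}{8}\right)\equiv0\pmod m.$$ (ii) If $\beta$ is a positive integer such that $c_2^\beta\equiv0\pmod m$, then for all $n\ge0$, $$p_{3k}\left(3^{2\nu\beta-1}n+\frac{k(3^{2\nu\beta}-1)}{8}\right)\equiv0\pmod m.$$
   Context: The integers $p_j(n)$ are defined by $\prod_{n\ge1}(1-q^n)^j=\sum_{n\ge0}p_j(n)q^n$. The integer sequences $C_k(\beta)$, $D_{k,i}(\beta)$ ($1\le k\le8$, $1\le i\le\lfloor k/3\rfloor$, $\beta\ge0$) are defined as follows: for each $k$ all of them satisfy $s(\beta+4)=h(k)s(\beta+2)+r(k)s(\beta)$ for $\beta\ge0$, with the following coefficients and initial values $(s(0),s(1),s(2),s(3))$: $k=1$: $h=-3$, $r=0$; $C_1:(1,-3,-3,9)$. $k=2$: $h=9$, $r=0$; $C_2:(1,9,9,81)$. $k=3$: $h=-12$, $r=-3^7$; $C_3:(1,0,-12,-2187)$; $D_{3,1}:(0,1,-243,-12)$. $k=4$: $h=-2\cdot3^2\cdot19$, $r=-3^{10}$; $C_4:(1,-243,-99,24057)$; $D_{4,1}:(0,-12,2916,4104)$. $k=5$: $h=2^2\cdot3^3\cdot17$,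 $r=-3^{13}$; $C_5:(1,2187,1107,2421009)$; $D_{5,1}:(0,90,-21870,165240)$. $k=6$: $h=-2\cdot3^2\cdot17\cdot23$, $r=-3^{16}$; $C_6:(1,-13122,-7038,49305915)$; $D_{6,1}:(0,-486,118098,3420468)$; $D_{6,2}:(0,1,-177147,-7038)$. $k=7$: $h=2^2\cdot3^3\cdot491$, $r=-3^{19}$; $C_7:(1,59049,33345,1968988905)$; $D_{7,1}:(0,1701,-413343,90200628)$; $D_{7,2}:(0,-21,3720087,-1113588)$. $k=8$: $h=-2\cdot3^4\cdot5\cdot359$, $r=-3^{22}$; $C_8:(1,-177147,-113643,20131516521)$; $D_{8,1}:(0,0,0,0)$; $D_{8,2}:(0,252,-44641044,-73279080)$. For $m\ge2$, $\nu_m(k)=\min\{\beta\ge1 : D_{k,i}(2\beta-1)\equiv0\pmod m\text{ for all }1\le i\le\lfloor k/3\rfloor\}$ (this minimum is known to exist for every $m\ge2$; for $k=1,2$ the condition is empty, so $\nu_m(k)=1$), and $c_2$ is the integer with $0\le c_2\le m-1$ and $c_2\equiv C_k(2\nu_m(k)-1)\pmod m$. *)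

(* Defs.v *)
From Stdlib Require Import ZArith.
From mathcomp Require Import all_boot all_order all_algebra.
From mathcomp Require Import zify ring ssrZ.

Set Implicit Arguments.
Unset Strict Implicit.
Unset Printing Implicit Defensive.

Import Order.TTheory GRing.Theory Num.Theory.

(* The recurrent sequences are computed in the binary integers Z and then sent
   to int, whose own numerals are unary: 20131516521 is not usable there. *)
Section Tables.
Local Open Scope Z_scope.

Fixpoint rec4 (h r s0 s1 s2 s3 : Z) (b : nat) : Z :=
  match b with
  | 0%N => s0
  | 1%N => s1
  | 2%N => s2
  | 3%N => s3
  | S (S ((S (S b0)) as b2)) =>
      h * rec4 h r s0 s1 s2 s3 b2 + r * rec4 h r s0 s1 s2 s3 b0
  end.

Definition h_coef (k : nat) : Z :=
  match k with
  | 1%N => - 3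
  | 2%N => 9
  | 3%N => - 12
  | 4%N => - (2 * 3 ^ 2 * 19)
  | 5%N => 2 ^ 2 * 3 ^ 3 * 17
  | 6%N => - (2 * 3 ^ 2 * 17 * 23)
  | 7%N => 2 ^ 2 * 3 ^ 3 * 491
  | 8%N => - (2 * 3 ^ 4 * 5 * 359)
  | _ => 0
  end.

Definition r_coef (k : nat) : Z :=
  match k with
  | 3%N => - 3 ^ 7
  | 4%N => - 3 ^ 10
  | 5%N => - 3 ^ 13
  | 6%N => - 3 ^ 16
  | 7%N => - 3 ^ 19
  | 8%N => - 3 ^ 22
  | _ => 0
  end.

Definition C_Z (k : nat) : nat -> Z :=
  let s := rec4 (h_coef k) (r_coef k) in
  match k with
  | 1%N => s 1 (- 3) (- 3) 9
  | 2%N => s 1 9 9 81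
  | 3%N => s 1 0 (- 12) (- 2187)
  | 4%N => s 1 (- 243) (- 99) 24057
  | 5%N => s 1 2187 1107 2421009
  | 6%N => s 1 (- 13122) (- 7038) 49305915
  | 7%N => s 1 59049 33345 1968988905
  | 8%N => s 1 (- 177147) (- 113643) 20131516521
  | _ => s 0 0 0 0
  end.

Definition D_Z (k i : nat) : nat -> Z :=
  let s := rec4 (h_coef k) (r_coef k) in
  match k, i with
  | 3%N, 1%N => s 0 1 (- 243) (- 12)
  | 4%N, 1%N => s 0 (- 12) 2916 4104
  | 5%N, 1%N => s 0 90 (- 21870) 165240
  | 6%N, 1%N => s 0 (- 486) 118098 3420468
  | 6%N, 2%N => s 0 1 (- 177147) (- 7038)
  | 7%N, 1%N => s 0 1701 (- 413343) 90200628
  | 7%N, 2%N => s 0 (- 21) 3720087 (- 1113588)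
  | 8%N, 1%N => s 0 0 0 0
  | 8%N, 2%N => s 0 252 (- 44641044) (- 73279080)
  | _, _ => s 0 0 0 0
  end.

End Tables.

Local Open Scope ring_scope.

Definition C (k b : nat) : int := int_of_Z (C_Z k b).
Definition D (k i b : nat) : int := int_of_Z (D_Z k i b).

(* Only the factors with i <= n contribute to the coefficient of q ^ n in the
   infinite product; see [p_coefE]. *)
Definition p_coef (j n : nat) : int :=
  (\prod_(1 <= i < n.+1) (1 - 'X^i : {poly int}) ^+ j)`_n.

Lemma p_coefE (j n N : nat) : (n <= N)%N ->
  (\prod_(1 <= i < N.+1) (1 - 'X^i : {poly int}) ^+ j)`_n = p_coef j n.
Proof.
move=> nN; rewrite /p_coef (big_cat_nat _ (n := n.+1)) //=.
set P := \prod_(1 <= i < n.+1) _.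
have [Q ->] : exists Q : {poly int},
    \prod_(n.+1 <= i < N.+1) (1 - 'X^i : {poly int}) ^+ j = 1 + Q * 'X^(n.+1).
  rewrite big_nat; elim/big_ind: _ => [|x y [Q ->] [R ->]|i /andP[ni _]].
  - by exists 0; rewrite mul0r addr0.
  - exists (Q + R + Q * 'X^(n.+1) * R).
    by ring.
  elim: j {P} => [|j [Q IH]]; first by exists 0; rewrite mul0r addr0.
  exists (Q - 'X^(i - n.+1) * (1 + Q * 'X^(n.+1))).
  rewrite exprS IH mulrBl mul1r mulrBl addrA; congr (_ - _).
  by rewrite mulrAC -exprD subnK.
by rewrite mulrDr mulr1 coefD mulrA coefMXn ltnSn addr0.
Qed.

Definition D_vanish (m k b : nat) : bool :=
  (0 < b)%N && all (fun i => (m %| D k i (2 * b - 1))%Z) (iota 1 (k %/ 3)).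

(* D_{k,i} at odd indices is a constant multiple of the Lucas sequence with
   parameters h(k), r(k).  That sequence vanishes modulo m infinitely often,
   which gives the existence of the minimum defining [nu]. *)
Section Existence.

Variables (h r : int).

Fixpoint lucas (n : nat) : int :=
  match n with
  | 0%N => 0
  | 1%N => 1
  | S ((S n0) as n1) => h * lucas n1 + r * lucas n0
  end.

Lemma lucasE n : lucas n.+2 = h * lucas n.+1 + r * lucas n.
Proof. by []. Qed.

Lemma lucas_pow3 (a n : nat) : (3 %| h)%Z -> (3 %| r)%Z -> (2 * a < n)%N ->
  ((3 ^ a)%N %| lucas n)%Z.
Proof.
move=> h3 r3; elim: a n => [|a IH] n; first by rewrite dvd1z.
case: n => [|[|[|n]]] ltn; [by lia | by lia | by lia | rewrite lucasE expnS PoszM].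
by rewrite rpredD // dvdz_mul // IH //; lia.
Qed.

Lemma intr_Zp0 (m : nat) (x : int) : (1 < m)%N ->
  (x%:~R == 0 :> 'Z_m) = (m %| x)%Z.
Proof.
move=> m1; rewrite dvdzE /=.
have n0 (n : nat) : (n%:R == 0 :> 'Z_m) = (m %| n)%N.
  by rewrite -val_eqE /= val_Zp_nat.
by case: x => n /=; rewrite ?NegzE ?mulrNz ?oppr_eq0 n0.
Qed.

Lemma lucas_period (m : nat) : (0 < m)%N -> coprime m `|r|%N ->
  exists2 T : nat, (0 < T)%N & forall q, (m %| lucas (T * q))%Z.
Proof.
case: m => [|[|m]] // _ cop; first by exists 1%N => // q; rewrite dvd1z.
set p := m.+2 in cop *.
pose f (v : 'Z_p * 'Z_p) : 'Z_p * 'Z_p :=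
  (v.2, h%:~R * v.2 + r%:~R * v.1).
have ur : (r%:~R : 'Z_p) \is a GRing.unit.
  have un (n : nat) : coprime p n -> (n%:R : 'Z_p) \is a GRing.unit.
    by move=> ?; rewrite unitZpE.
  by case: (r) cop => n /un //; rewrite NegzE mulrNz unitrN.
have inj_f : injective f.
  move=> [x y] [x' y'] /eqP; rewrite xpair_eqE /= => /andP[/eqP ->].
  by rewrite (inj_eq (addrI _)) => /eqP/(mulrI ur) ->.
have iterE n : iter n f (0, 1) = ((lucas n)%:~R, (lucas n.+1)%:~R).
  elim: n => [|n IH] //.
  by rewrite iterS IH /f /= -/(lucas n.+1) intrD !intrM.
exists (order f (0, 1)) => [|q]; first exact: order_gt0.
have fix0 : iter (order f (0, 1) * q) f (0, 1) = (0, 1).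
  elim: q => [|q IH]; first by rewrite muln0.
  by rewrite mulnS iterD IH iter_order.
by rewrite -intr_Zp0 //; move: fix0; rewrite iterE => -[-> _].
Qed.

Lemma lucas_dvd (m e : nat) : (0 < m)%N -> (3 %| h)%Z -> `|r|%N = (3 ^ e.+1)%N ->
  exists b : nat, (m %| lucas b.+1)%Z.
Proof.
move=> m0 h3 rE.
have r3 : (3 %| r)%Z by rewrite dvdzE rE expnS dvdn_mulr.
have c3 : coprime (m`_(3%N)^')%N 3%N.
  by rewrite coprime_sym (@pnat_coprime 3%N) ?part_pnat ?pnat_id.
have [||T T0 HT] := @lucas_period (m`_(3%N)^')%N; first exact: part_gt0.
  by rewrite rE coprimeXr.
have : (m %| lucas (T * (2 * logn 3%N m).+1))%Z.
  rewrite dvdzE /= -{1}(partnC 3%N m0) Gauss_dvd ?coprime_partC //.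
  apply/andP; split; last by have := HT (2 * logn 3%N m).+1; rewrite dvdzE /=.
  rewrite p_part; suff: ((3 ^ logn 3%N m)%N %| lucas (T * (2 * logn 3%N m).+1))%Z.
    by rewrite dvdzE.
  by apply: lucas_pow3 => //; exact: leq_pmull.
case E: (_ * _)%N => [|b] H; last by exists b.
by move: E T0; case: (T).
Qed.

End Existence.

Lemma D_ZE (k i b : nat) :
  D_Z k i b.+4 = (h_coef k * D_Z k i b.+2 + r_coef k * D_Z k i b)%R.
Proof.
by do 9?[case: k => [|k] //]; do 3?[case: i => [|i] //].
Qed.

Lemma D_rec (k i b : nat) : D k i b.+4 =
  int_of_Z (h_coef k) * D k i b.+2 + int_of_Z (r_coef k) * D k i b.
Proof. by rewrite /D D_ZE rmorphD !rmorphM. Qed.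

Lemma D_Z3 (k i : nat) : D_Z k i 3 = (h_coef k * D_Z k i 1)%R.
Proof.
by do 9?[case: k => [|k] //]; do 3?[case: i => [|i] //].
Qed.

Lemma D_odd (k i b : nat) : D k i (2 * b).+1 =
  D k i 1 * lucas (int_of_Z (h_coef k)) (int_of_Z (r_coef k)) b.+1.
Proof.
set L := lucas _ _.
suff [] : D k i (2 * b).+1 = D k i 1 * L b.+1 /\
          D k i (2 * b).+3 = D k i 1 * L b.+2 by [].
elim: b => [|b [IH1 IH2]].
  split; first by rewrite /= mulr1.
  rewrite /D D_Z3 rmorphM /= mulr0 addr0 mulr1; exact: mulrC.
rewrite mulnS; split=> //.
rewrite D_rec IH1 IH2 /L [in RHS]lucasE.
by rewrite [in RHS]mulrDr (mulrCA _ (D k i 1)) (mulrCA _ (D k i 1)).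
Qed.

Lemma D_vanish_ex (m k : nat) : (1 < m)%N -> exists b, D_vanish m k b.
Proof.
move=> m1; have m0 := ltnW m1.
suff [b Hb] : exists b, forall i, (m %| D k i (2 * b).+1)%Z.
  exists b.+1; apply/allP => i _.
  by have -> : (2 * b.+1 - 1 = (2 * b).+1)%N by lia.
have [k38|k38] := boolP (3 <= k <= 8)%N; last first.
  exists 0%N => i; suff -> : D k i (2 * 0).+1 = 0 by rewrite dvdz0.
  by move: k38; do 9?[case: k => [|k] //]; case: i => [|[|[|i]]].
have h3 : (3 %| int_of_Z (h_coef k))%Z.
  have [z ->] : exists z, h_coef k = (z * 3)%R.
    exists (Z.div (h_coef k) (Zpos 3)).
    by move: k38; do 9?[case: k => [|k] //].
  by rewrite rmorphM /= dvdz_mull.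
have [e re] : exists e, `|int_of_Z (r_coef k)|%N = (3 ^ e.+1)%N.
  have [e re] : exists e : nat, r_coef k = - ((3 : Z) ^+ e.+1).
    exists (nth 0%N [:: 6; 9; 12; 15; 18; 21] (k - 3))%N.
    by move: k38 {h3}; do 9?[case: k => [|k] //].
  by exists e; rewrite re rmorphN rmorphXn /= abszN abszX.
have [b Hb] := lucas_dvd m0 h3 re.
by exists b => i; rewrite D_odd dvdz_mull.
Qed.

Definition nu (m k : nat) (m_gt1 : (1 < m)%N) : nat :=
  ex_minn (D_vanish_ex k m_gt1).

Definition c2 (m k : nat) (m_gt1 : (1 < m)%N) : int :=
  (C k (2 * nu k m_gt1 - 1) %% m)%Z.

(* The two index formulas of the congruences involve exact quotients and no
   truncated subtraction. *)
Lemma sqr_index_exact (x : nat) : (8 * ((3 ^ (2 * x) - 1) %/ 8) + 1 = 3 ^ (2 * x))%N.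
Proof.
by elim: x => [|x IH] //; rewrite mulnS expnD; lia.
Qed.

Lemma index_i_exact (k i x : nat) : (0 < x)%N ->
  (8 * (((3 * k + 8 * i) * 3 ^ (2 * x - 1) - k) %/ 8) + k
   = (3 * k + 8 * i) * 3 ^ (2 * x - 1))%N.
Proof.
case: x => // x _; have -> : (2 * x.+1 - 1 = (2 * x).+1)%N by lia.
move: (sqr_index_exact x); set q := (_ %/ 8)%N => E.
rewrite expnS -E {E}.
have -> : ((3 * k + 8 * i) * (3 * (8 * q + 1)) =
   8 * (9 * k * q + k + 3 * i * (8 * q + 1)) + k)%N by lia.
by rewrite addnK mulKn.
Qed.

Lemma index_ii_exact (k x : nat) :
  (8 * ((k * (3 ^ (2 * x) - 1)) %/ 8) = k * (3 ^ (2 * x) - 1))%N.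
Proof.
move: (sqr_index_exact x); set q := (_ %/ 8)%N => E.
rewrite -E addnK {E}.
by rewrite mulnCA mulKn // mulnCA.
Qed.

(* Main.v *)
(* Write E_j for the series prod (1 - q^(j n)).  By Jacobi's identity
   E_1^3 = sum (-1)^n (2n+1) q^(n(n+1)/2), the part of E_1^3 in q^(3n+2) vanishes
   and the part in q^(3n+1) is -3 q E_9^3, so z = E_1^3 / E_9^3 has the form
   T - 3q with T a series in q^3.  Taking the product over the cube roots of unity
   w of the E(w q) gives T^3 = E_3^12 / E_9^12 + 27 q^3, i.e. z is a root of
   z^3 + 9 q z^2 + 27 q^2 z = E_3^12 / E_9^12.  Hence extracting the terms q^(3n)
   of shifted powers of z obeys a three-term linear recursion with an explicit
   solution.  Extracting alternately the terms q^(3n+k) and q^(3n) from E_1^(3k)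
   therefore gives, at even steps 2b, the series
     sum_i D_i(2b) q^i E_1^(3k-12i) E_3^(12i)
   and, at odd steps 2b+1,
     sum_i D_i(2b+1) q^(-i) E_1^(12i) E_3^(3k-12i),
   with D_0 = C_k; since both the step matrices and the recurrence are linear, it
   is enough to compare the tables for b <= 1.  Modulo m, at the odd step 2 nu - 1
   only C_k(2 nu - 1) E_3^(3k) is left, which is a series in q^3 whose coefficients
   are again c_2 p_{3k}, and one iterates. *)

From Stdlib Require Import ZArith.
Require Import Defs.
From HB Require Import structures.
From mathcomp Require Import all_boot all_order all_algebra.
From mathcomp Require Import zify ring ssrZ.
From mathcomp Require Import boolp functions.

Set Implicit Arguments.
Unset Strict Implicit.
Unset Printing Implicit Defensive.

Import Order.TTheory GRing.Theory Num.Theory.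

Local Open Scope ring_scope.

(** * Formal power series *)

(** A name distinct from the function type, so that multiplication can be the Cauchy product and not
    the pointwise one. *)
Definition series (R : Type) := nat -> R.

HB.instance Definition _ (R : comNzRingType) :=
  GRing.Zmodule.copy (series R) (nat -> R).

Section SeriesRing.
Variable R : comNzRingType.
Implicit Types f g h : series R.

Definition series_one : series R := fun n => (n == 0%N)%:R.
Definition series_mul f g : series R :=
  fun n => \sum_(i < n.+1) f i * g (n - i)%N.

(** Only finitely many coefficients enter, so ring axioms reduce to those of polynomials. *)
Lemma series_mul_trunc f g (N n : nat) : (n < N)%N ->
  series_mul f g n = ((\poly_(i < N) f i) * (\poly_(i < N) g i))`_n.
Proof.
move=> nN; rewrite coefM; apply: eq_bigr => i _; rewrite !coef_poly.
by rewrite !ifT //; have := ltn_ord i; lia.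
Qed.

Lemma series_mulA : associative series_mul.
Proof.
move=> f g h; apply/funext => n.
transitivity ((\poly_(i < n.+1) f i * (\poly_(i < n.+1) g i *
                \poly_(i < n.+1) h i))`_n).
  rewrite coefM; apply: eq_bigr => i _; rewrite coef_poly ltn_ord.
  by rewrite -series_mul_trunc //; have := ltn_ord i; lia.
rewrite mulrA coefM; apply: eq_bigr => i _.
by rewrite -series_mul_trunc // coef_poly ifT //; have := ltn_ord i; lia.
Qed.

Lemma series_mulC : commutative series_mul.
Proof.
move=> f g; apply/funext => n.
by rewrite !(@series_mul_trunc _ _ n.+1) // mulrC.
Qed.

Lemma series_mul1 : left_id series_one series_mul.
Proof.
move=> f; apply/funext => n; rewrite /series_mul big_ord_recl /= mul1r subn0.
by rewrite big1 ?addr0 // => i _; rewrite mul0r.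
Qed.

Lemma series_mulDl : left_distributive series_mul +%R.
Proof.
move=> f g h; apply/funext => n; rewrite /series_mul /= -[RHS]big_split /=.
by apply: eq_bigr => i _; rewrite -mulrDl.
Qed.

Lemma series_one_neq0 : series_one != 0.
Proof. by apply/eqP => /(congr1 (@^~ 0%N))/eqP; rewrite /series_one oner_eq0. Qed.

HB.instance Definition _ := GRing.Zmodule_isComNzRing.Build (series R)
  series_mulA series_mulC series_mul1 series_mulDl series_one_neq0.
End SeriesRing.


Section SeriesTheory.
Variable R : comNzRingType.
Implicit Types (f g h a b : series R) (p : {poly R}).

Lemma series_coefD f g n : (f + g) n = f n + g n. Proof. by []. Qed.
Lemma series_coefN f n : (- f) n = - f n. Proof. by []. Qed.
Lemma series_coefM f g n : (f * g) n = \sum_(i < n.+1) f i * g (n - i)%N.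
Proof. by []. Qed.

Definition ofp p : series R := fun n => p`_n.

Lemma ofp_is_zmod_morphism : zmod_morphism ofp.
Proof. by move=> p p'; apply/funext => n; rewrite /ofp coefB. Qed.

Lemma ofp_is_monoid_morphism : monoid_morphism ofp.
Proof.
split=> [|p p']; apply/funext => n; first by rewrite /ofp coef1.
by rewrite /ofp coefM series_coefM.
Qed.

HB.instance Definition _ :=
  GRing.isZmodMorphism.Build {poly R} (series R) ofp ofp_is_zmod_morphism.
HB.instance Definition _ :=
  GRing.isMonoidMorphism.Build {poly R} (series R) ofp ofp_is_monoid_morphism.

Definition q : series R := ofp 'X.

Lemma q_expE k : q ^+ k = ofp 'X^k.
Proof. by rewrite -rmorphXn. Qed.

Lemma coef_qM k f n : (q ^+ k * f) n = if (n < k)%N then 0 else f (n - k)%N.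
Proof.
rewrite q_expE series_coefM; case: ltnP => [nk|kn].
  rewrite big1 // => i _; rewrite /ofp coefXn ltn_eqF ?mul0r //.
  by have := ltn_ord i; lia.
have kn' : (k < n.+1)%N by [].
rewrite (bigD1 (Ordinal kn')) //= /ofp coefXn eqxx mul1r big1 ?addr0 // => i ik.
by move: ik; rewrite -val_eqE coefXn /= => /negbTE ->; rewrite mul0r.
Qed.

Lemma q_inj k : injective ( *%R (q ^+ k)).
Proof.
move=> f g fg; apply/funext => n.
have := congr1 (@^~ (n + k)%N) fg.
by rewrite !coef_qM ltnNge leq_addl /= addnK.
Qed.

Lemma coef_intrM (c : int) f n : (c%:~R * f) n = c%:~R * f n.
Proof.
have E m : (f *+ m) n = f n *+ m by elim: m => [|m IH] //; rewrite !mulrS -IH.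
by rewrite !mulrzl; case: c => m; rewrite ?NegzE ?mulrNz ?series_coefN -!pmulrn E. Qed.

(** Congruence modulo [q ^+ N]: infinite products and sums are handled through polynomials that
    agree with them to every order. *)
Definition congq N f g := forall n, (n < N)%N -> f n = g n.

Lemma congq_refl N f : congq N f f. Proof. by []. Qed.

Lemma congq_sym N f g : congq N f g -> congq N g f.
Proof. by move=> fg n nN; rewrite fg. Qed.

Lemma congq_trans N f g h : congq N f g -> congq N g h -> congq N f h.
Proof. by move=> fg gh n nN; rewrite fg // gh. Qed.

Lemma congqW M N f g : (M <= N)%N -> congq N f g -> congq M f g.
Proof. by move=> MN fg n nM; apply: fg; apply: leq_trans nM MN. Qed.

Lemma congqP f g : (forall N, congq N f g) -> f = g.
Proof. by move=> fg; apply/funext => n; apply: fg (ltnSn n). Qed.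

Lemma congqD N f f' g g' :
  congq N f f' -> congq N g g' -> congq N (f + g) (f' + g').
Proof. by move=> ff gg n nN; rewrite !series_coefD ff // gg. Qed.

Lemma congqB N f f' g g' :
  congq N f f' -> congq N g g' -> congq N (f - g) (f' - g').
Proof. by move=> ff gg n nN; rewrite !series_coefD !series_coefN ff // gg. Qed.

Lemma congqM N f f' g g' :
  congq N f f' -> congq N g g' -> congq N (f * g) (f' * g').
Proof.
move=> ff gg n nN; rewrite !series_coefM; apply: eq_bigr => i _.
by rewrite ff ?gg //; have := ltn_ord i; lia.
Qed.

Lemma congqX N f g k : congq N f g -> congq N (f ^+ k) (g ^+ k).
Proof. by move=> fg; elim: k => [|k IH] //; rewrite !exprS; apply: congqM. Qed.

Lemma congq_sum N (I : Type) (r : seq I) (F G : I -> series R) :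
  (forall i, congq N (F i) (G i)) ->
  congq N (\sum_(i <- r) F i) (\sum_(i <- r) G i).
Proof.
move=> FG; elim/big_rec2: _ => [|i f g _ fg]; first exact: congq_refl.
exact: congqD.
Qed.

Lemma congq_trunc N f : congq N f (ofp (\poly_(i < N) f i)).
Proof. by move=> n nN; rewrite /ofp coef_poly nN. Qed.

(** Geometric series in [u = 1 - f], which is divisible by [q]. *)
Lemma series_inv f : f 0%N = 1 -> exists g, f * g = 1.
Proof.
move=> f0; pose u := 1 - f.
have u0 k : congq k (u ^+ k) 0.
  have [v uE] : exists v, u = q ^+ 1 * v.
    exists (fun n => u n.+1); apply/funext => -[|n]; rewrite coef_qM //=.
      by rewrite /u series_coefD series_coefN f0 subrr.
    by rewrite subn1.
  by move=> n nk; rewrite uE exprMn -exprM mul1n coef_qM nk.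
pose s N := \sum_(i < N) u ^+ i.
(* The coefficient of [q ^+ n] is stable from the partial sum [s n.+1] on, so the limit is read off
   along this diagonal. *)
exists (fun n => s n.+1 n); apply/congqP => N.
have sE : congq N (fun n => s n.+1 n) (s N).
  move=> n nN; rewrite /s -!(big_mkord xpredT (fun i => u ^+ i)).
  rewrite [in RHS](big_cat_nat _ (n := n.+1)) //= series_coefD.
  rewrite [X in _ = _ + X](_ : _ = 0) ?addr0 //.
  rewrite big_nat; elim/big_rec: _ => [|i v /andP[ni _] v0] //.
  by rewrite series_coefD v0 u0 // addr0.
apply: congq_trans (congqM (congq_refl f) sE) _.
have -> : f * s N = 1 - u ^+ N.
  by rewrite -[1 - u ^+ N]opprB subrX1 /s /u; ring.
by rewrite -[X in congq _ _ X]subr0; apply: congqB.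
Qed.

(** * The substitution of q^3 for q, and dissection modulo 3 *)

Definition phi f : series R := fun n => if (3 %| n)%N then f (n %/ 3)%N else 0.

Lemma phi_congq N f g : congq N f g -> congq (3 * N) (phi f) (phi g).
Proof.
move=> fg n nN; rewrite /phi; case: ifP => // _; apply: fg.
by rewrite ltn_divLR // mulnC.
Qed.

Lemma phi_ofp p : phi (ofp p) = ofp (p \Po 'X^3).
Proof. by apply/funext => n; rewrite /phi /ofp coef_comp_poly_Xn. Qed.

Lemma phi_is_zmod_morphism : zmod_morphism phi.
Proof.
move=> f g; apply/funext => n.
rewrite series_coefD series_coefN /phi; case: ifP => // _.
by rewrite subr0.
Qed.

Lemma phi_is_monoid_morphism : monoid_morphism phi.
Proof.
split=> [|f g].
  by rewrite -[1 in LHS](rmorph1 ofp) phi_ofp comp_polyC rmorph1.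
apply: congqP => N.
have le3 : (N <= 3 * N)%N by lia.
have tr h := congqW le3 (phi_congq (@congq_trunc N h)).
apply: congq_trans (congq_sym (congqM (tr f) (tr g))).
rewrite !phi_ofp -rmorphM -comp_polyM /= -phi_ofp.
apply: congqW le3 (phi_congq _).
by rewrite rmorphM; apply: congqM; apply: congq_trunc.
Qed.

HB.instance Definition _ :=
  GRing.isZmodMorphism.Build (series R) (series R) phi phi_is_zmod_morphism.
HB.instance Definition _ :=
  GRing.isMonoidMorphism.Build (series R) (series R) phi phi_is_monoid_morphism.

Lemma phi_q : phi q = q ^+ 3.
Proof. by rewrite phi_ofp comp_polyX q_expE. Qed.

Definition U (r : nat) f : series R := fun n => f (3 * n + r)%N.

Lemma U_is_zmod_morphism r : zmod_morphism (U r).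
Proof. by []. Qed.

HB.instance Definition _ r :=
  GRing.isZmodMorphism.Build (series R) (series R) (U r) (U_is_zmod_morphism r).

Lemma U_congq N r f g : (r < 3)%N -> congq (3 * N) f g -> congq N (U r f) (U r g).
Proof. by move=> r3 fg n nN; apply: fg; lia. Qed.

Lemma U_qphi (r j : nat) f : (r < 3)%N -> (j < 3)%N ->
  U r (q ^+ j * phi f) = if r == j then f else 0.
Proof.
move=> r3 j3; apply/funext => n; rewrite /U coef_qM /phi.
case: eqP => [->|rj].
  rewrite ltnNge leq_addl /= addnK dvdn_mulr //.
  by rewrite mulKn.
by case: ltnP => // lej; case: ifP => // /dvdnP[x]; lia.
Qed.

Lemma dissection f : f = phi (U 0 f) + q * phi (U 1 f) + q ^+ 2 * phi (U 2 f).
Proof.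
apply/funext => n; rewrite !series_coefD -{1}[q]expr1 !coef_qM /phi /U.
have [r3 ->] : (n %% 3 < 3)%N /\ n = (n %/ 3 * 3 + n %% 3)%N.
  by rewrite -divn_eq ltn_mod.
move: (n %/ 3)%N (n %% 3)%N r3 => x [|[|[|//]]] _.
- rewrite addn0 dvdn_mull // mulnK // addn0 (mulnC x).
  case: x => [|x]; first by rewrite !addr0.
  by rewrite !ifF ?addr0 //; apply/negbTE; lia.
- rewrite addnK dvdn_mull // mulnK // (mulnC x).
  case: x => [|x]; first by rewrite add0r addr0.
  by rewrite ifF ?add0r ?ifF ?addr0 //; apply/negbTE; lia.
rewrite addnK dvdn_mull // mulnK // (mulnC x).
by rewrite ifF ?add0r ?ifF ?ifF ?add0r ?ifF //; apply/negbTE; lia.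
Qed.

(** Multiplication by a series in q^3 preserves each residue class of exponents modulo 3. *)
Lemma U_phiM r a b : (r < 3)%N -> U r (phi a * b) = a * U r b.
Proof.
move=> r3; rewrite [b in LHS]dissection !mulrDr mulrCA (mulrCA (phi a) (q ^+ 2)).
rewrite -{1}[q]expr1 -[phi a * _]mul1r -(expr0 q) -!rmorphM !raddfD /= !U_qphi //.
by move: r3; case: r => [|[|[|]]] //= _; rewrite ?addr0 ?add0r.
Qed.

Lemma U_phi r f : (r < 3)%N -> U r (phi f) = if r == 0%N then f else 0.
Proof. by move=> r3; rewrite -(U_qphi f r3 (isT : 0 < 3)%N) mul1r. Qed.

(* The norm [f(q) f(w q) f(w^2 q)] with [w] a primitive cube root of unity,
   read as a series in [q^3]. *)
Definition norm3 f : series R :=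
  U 0 f ^+ 3 + q * U 1 f ^+ 3 + q ^+ 2 * U 2 f ^+ 3 -
  3%:R * q * U 0 f * U 1 f * U 2 f.

Lemma norm3E a b c :
  norm3 (phi a + q * phi b + q ^+ 2 * phi c) =
  a ^+ 3 + q * b ^+ 3 + q ^+ 2 * c ^+ 3 - 3%:R * q * a * b * c.
Proof.
have E r : (r < 3)%N -> U r (phi a + q * phi b + q ^+ 2 * phi c) =
    if r == 0%N then a else if r == 1%N then b else c.
  move=> r3; rewrite -{1}[q]expr1 !raddfD /= U_phi // !U_qphi //.
  by move: r3; case: r => [|[|[|]]] //= _; rewrite ?addr0 ?add0r.
by rewrite /norm3 !E.
Qed.

(** Instead of adjoining a cube root of unity, both factors are dissected; multiplicativity is then
    a polynomial identity in their six components. *)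
Lemma norm3M f g : norm3 (f * g) = norm3 f * norm3 g.
Proof.
rewrite [f]dissection [g]dissection.
move: (U 0 f) (U 1 f) (U 2 f) (U 0 g) (U 1 g) (U 2 g) => a b c a' b' c'.
rewrite !norm3E.
have -> : (phi a + q * phi b + q ^+ 2 * phi c) *
          (phi a' + q * phi b' + q ^+ 2 * phi c') =
   phi (a * a' + q * (b * c' + c * b')) +
   q * phi (a * b' + b * a' + q * c * c') +
   q ^+ 2 * phi (a * c' + b * b' + c * a').
  by rewrite !(rmorphM, rmorphD) /= phi_q; ring.
by rewrite norm3E; ring.
Qed.

Lemma norm3_congq N f g : congq (3 * N) f g -> congq N (norm3 f) (norm3 g).
Proof.
move=> fg.
have E r : (r < 3)%N -> congq N (U r f) (U r g) by move=> ?; apply: U_congq.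
by rewrite /norm3; apply: congqB;
  repeat (apply: congqD || apply: congqM || apply: congqX || apply: congq_refl
    || apply: E).
Qed.

End SeriesTheory.

Arguments q {R}.

(** * Jacobi's identity *)

(** The Gaussian binomial coefficient, given by its Pascal rule to avoid division in [A]. *)
Fixpoint qbin (A : comNzRingType) (x : A) n k : A :=
  match n, k with
  | _, 0%N => 1
  | 0%N, _.+1 => 0
  | n'.+1, k'.+1 => qbin x n' k' + x ^+ k * qbin x n' k
  end.
Arguments qbin : simpl never.

Section QBinomial.
Variables (A : comNzRingType) (x : A).

Definition qpoch n : A := \prod_(1 <= i < n.+1) (1 - x ^+ i).

Lemma qpoch0 : qpoch 0 = 1.
Proof. by rewrite /qpoch big_geq. Qed.

Lemma qpochS n : qpoch n.+1 = qpoch n * (1 - x ^+ n.+1).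
Proof. by rewrite /qpoch big_nat_recr. Qed.

Lemma qbinn0 n : qbin x n 0 = 1.
Proof. by case: n. Qed.

Lemma qbinSS n k : qbin x n.+1 k.+1 = qbin x n k + x ^+ k.+1 * qbin x n k.+1.
Proof. by []. Qed.

Lemma qbin_small n k : (n < k)%N -> qbin x n k = 0.
Proof.
elim: n k => [|n IH] [|k] // nk.
by rewrite qbinSS !IH ?mulr0 ?addr0 //; lia.
Qed.

Lemma qbinnn n : qbin x n n = 1.
Proof.
by elim: n => [|n IH] //; rewrite qbinSS IH qbin_small // mulr0 addr0.
Qed.

Lemma qbin_qpoch k l : qpoch k * qpoch l * qbin x (k + l) k = qpoch (k + l).
Proof.
have [n] := ubnP (k + l)%N; elim: n k l => // n IH [|k] [|l] lt_n.
- by rewrite qpoch0 qbinn0 !mul1r.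
- by rewrite qpoch0 qbinn0 mul1r mulr1.
- by rewrite addn0 qpoch0 qbinnn !mulr1.
have IHk : qpoch k * qpoch l.+1 * qbin x (k + l).+1 k = qpoch (k + l).+1.
  by rewrite -addnS IH //; lia.
have IHl : qpoch k.+1 * qpoch l * qbin x (k + l).+1 k.+1 = qpoch (k + l).+1.
  by rewrite -addSn IH //; lia.
rewrite addSn addnS qbinSS [RHS]qpochS.
have -> : x ^+ (k + l).+2 = x ^+ k.+1 * x ^+ l.+1 by rewrite -exprD addSn addnS.
(* This rests on 1 - x^(k+l+2) = (1 - x^(k+1)) + x^(k+1) (1 - x^(l+1)). *)
transitivity ((1 - x ^+ k.+1) * (qpoch k * qpoch l.+1 * qbin x (k + l).+1 k) +
  x ^+ k.+1 * (1 - x ^+ l.+1) * (qpoch k.+1 * qpoch l * qbin x (k + l).+1 k.+1)).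
  by rewrite !qpochS; ring.
by rewrite IHk IHl; ring.
Qed.

Lemma bin2S a : ('C(a.+1, 2) = 'C(a, 2) + a)%N.
Proof. by rewrite binS bin1. Qed.

Lemma bin2D a b : ('C(a + b, 2) = 'C(a, 2) + 'C(b, 2) + a * b)%N.
Proof.
elim: a => [|a IH]; first by rewrite bin0n addn0.
by rewrite addSn !bin2S IH mulSn; lia.
Qed.

(** The homogeneous form lets [a] be a polynomial variable, to be differentiated later. The
    induction takes out the factor [i = 0] and applies the hypothesis to z x. *)
Lemma qbinomial n (a z : A) :
  \prod_(0 <= i < n) (a + z * x ^+ i) =
  \sum_(0 <= k < n.+1) x ^+ 'C(k, 2) * qbin x n k * z ^+ k * a ^+ (n - k).
Proof.
elim: n z => [|n IH] z.
  by rewrite big_geq // big_nat1 bin0n qbinn0 !expr0 !mulr1.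
rewrite big_nat_recl // expr0 mulr1.
under eq_bigr => i _ do rewrite exprS mulrA.
rewrite IH mulrDl [in RHS]big_nat_recl //= bin0n qbinn0 !expr0 !mul1r subn0.
under [X in _ = _ + X]eq_bigr => k _.
  rewrite qbinSS subSS bin2S mulrDr !mulrDl.
  over.
rewrite big_split /= [in X in _ = _ + (_ + X)]big_nat_recr //=.
rewrite (qbin_small (ltnSn n)) !(mulr0, mul0r) addr0.
rewrite (addrC (\sum_(0 <= i < n.+1) _)) addrA; congr (_ + _).
  rewrite big_nat_recl //= bin0n qbinn0 !expr0 !mul1r subn0 mulrDr mulr_sumr.
  rewrite exprS; congr (_ + _).
  apply: eq_big_nat => k /andP[_ kn]; rewrite bin2S.
  have -> : (n - k = (n - k.+1).+1)%N by lia.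
  by rewrite exprMn !exprD !exprS; ring.
rewrite mulr_sumr; apply: eq_bigr => k _.
by rewrite exprMn !exprD !exprS; ring.
Qed.

End QBinomial.

Lemma rmorph_qbin (A B : comNzRingType) (u : {rmorphism A -> B}) (x : A) n k :
  u (qbin x n k) = qbin (u x) n k.
Proof.
elim: n k => [|n IH] [|k]; rewrite ?rmorph1 ?rmorph0 //.
by rewrite !qbinSS rmorphD rmorphM rmorphXn !IH.
Qed.

(** This lemma and the next compute the power of x in two terms symmetric about the middle of a sum
    of 2m + 2 terms, with m = d + n here and m = d + 1 + n there; the two powers coincide. *)
Lemma jacobi_exponent_low d n :
  ('C(d, 2) + (d + n) * (d + n + n) =
   'C(d + n, 2) + (d + n) * (d + n) + 'C(n.+1, 2))%N.
Proof.
have n2 : ('C(n, 2) * 2 + n = n * n)%N by elim: (n) => // j; rewrite bin2S; lia.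
by rewrite bin2D bin2S; nia.
Qed.

Lemma jacobi_exponent_high d n :
  ('C((d.+1 + n + n).+1, 2) + (d.+1 + n) * d =
   'C(d.+1 + n, 2) + (d.+1 + n) * (d.+1 + n) + 'C(n.+1, 2))%N.
Proof.
have n2 : ('C(n, 2) * 2 + n = n * n)%N by elim: (n) => // j; rewrite bin2S; lia.
by rewrite !(bin2S, bin2D); nia.
Qed.

Section FiniteJacobi.
Variables (A : comNzRingType) (x : A).

(* Differentiate [\prod_(i < n) ('X - x ^+ i)] at its root [x ^+ m]. *)
Lemma qbinomial_deriv n m : (m < n)%N ->
  \prod_(0 <= i < m) (x ^+ m - x ^+ i) *
    \prod_(m.+1 <= i < n) (x ^+ m - x ^+ i) =
  \sum_(0 <= k < n.+1)
    (-1) ^+ k * (x ^+ 'C(k, 2) * qbin x n k * x ^+ (m * (n - k).-1)) *+ (n - k).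
Proof.
move=> mn.
have := qbinomial x%:P n 'X (-1).
under eq_bigr => i _ do rewrite -polyC_exp mulN1r.
under [RHS]eq_bigr => k _.
  rewrite -polyC_exp -(rmorph_qbin polyC) -polyCM -polyCN -polyC_exp -polyCM.
  rewrite mul_polyC.
  over.
have -> : \prod_(0 <= i < n) ('X - (x ^+ i)%:P) = ('X - (x ^+ m)%:P) *
    (\prod_(0 <= i < m) ('X - (x ^+ i)%:P) *
     \prod_(m.+1 <= i < n) ('X - (x ^+ i)%:P)).
  rewrite (big_cat_nat _ (n := m)) //=; last exact: ltnW.
  by rewrite (big_ltn mn) /= mulrCA.
move=> /(congr1 (fun p : {poly A} => p^`().[x ^+ m])).
rewrite derivM derivXsubC mul1r hornerD !hornerM hornerXsubC subrr mul0r addr0.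
rewrite !horner_prod.
under eq_bigr => i _ do rewrite hornerXsubC.
under [X in _ * X]eq_bigr => i _ do rewrite hornerXsubC.
move=> ->; rewrite raddf_sum /= horner_sum; apply: eq_bigr => k _.
rewrite derivZ derivXn hornerZ hornerMn hornerXn -exprM mulrnAr.
by congr (_ *+ _); ring.
Qed.

Lemma prod_qpoch_low m :
  \prod_(0 <= i < m) (x ^+ m - x ^+ i) = (-1) ^+ m * x ^+ 'C(m, 2) * qpoch x m.
Proof.
transitivity (\prod_(0 <= i < m) (- x ^+ i * (1 - x ^+ (m - i)))).
  apply: eq_big_nat => i /andP[_ im].
  by rewrite mulNr mulrBr mulr1 -exprD subnKC ?opprB // ltnW.
rewrite big_split /=; congr (_ * _).
  elim: m => [|m IH]; first by rewrite big_geq // bin0n !expr0 mulr1.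
  by rewrite big_nat_recr //= IH bin2S exprS exprD; ring.
rewrite big_nat_rev /= /qpoch big_add1 /=; apply: eq_big_nat => i im.
by congr (1 - x ^+ _); lia.
Qed.

Lemma prod_qpoch_high m :
  \prod_(m.+1 <= i < (2 * m).+1) (x ^+ m - x ^+ i) = x ^+ (m * m) * qpoch x m.
Proof.
have -> : ((2 * m).+1 = m.+1 + m)%N by lia.
rewrite -[index_iota m.+1 _]/(index_iota (0 + m.+1) _) big_addn addKn /qpoch big_add1 /=.
transitivity (\prod_(0 <= i < m) (x ^+ m * (1 - x ^+ i.+1))).
  apply: eq_bigr => i _; rewrite mulrBr mulr1 -exprD.
  by congr (_ - x ^+ _); lia.
by rewrite big_split /= prodr_const_nat subn0 exprM.
Qed.

(** Take 2m + 1 for [n] in [qbinomial_deriv] and pair the terms k = m - n and k = m + n + 1. The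
    power of [x] common to all pairs stays on both sides, since [x] may fail to be regular in
    [A]. *)
Lemma finite_jacobi_scaled m :
  x ^+ ('C(m, 2) + m * m) * qpoch x m ^+ 2 =
  x ^+ ('C(m, 2) + m * m) * \sum_(0 <= n < m.+1)
    (-1) ^+ n * x ^+ 'C(n.+1, 2) *
     ((m + n).+1%:R * qbin x (2 * m).+1 (m - n) -
      (m - n)%:R * qbin x (2 * m).+1 (m + n).+1).
Proof.
have lt_m : (m < (2 * m).+1)%N by lia.
have := qbinomial_deriv lt_m.
rewrite prod_qpoch_low prod_qpoch_high.
have -> : ((2 * m).+2 = m.+1 + m.+1)%N by lia.
rewrite (big_cat_nat _ (n := m.+1)) //=; last by lia.
rewrite -[index_iota m.+1 _]/(index_iota (0 + m.+1) _) big_addn addnK big_nat_rev /= -big_split /=.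
move=> E; apply: (@can_inj _ _ ( *%R ((-1) ^+ m)) ( *%R ((-1) ^+ m))).
  by move=> a; rewrite mulrA -expr2 sqrr_sign mul1r.
transitivity ((-1) ^+ m * x ^+ 'C(m, 2) * qpoch x m * (x ^+ (m * m) * qpoch x m)).
  by rewrite exprD; ring.
rewrite E mulrA mulr_sumr; apply: eq_big_nat => n /andP[_ nm].
have [d ->] : exists d, m = (d + n)%N by exists (m - n)%N; lia.
rewrite !addnK.
have -> : (0 + (d + n).+1 - n.+1 = d)%N by lia.
have -> : ((2 * (d + n)).+1 - d = (d + n + n).+1)%N by lia.
have -> : (n + (d + n).+1 = (d + n + n).+1)%N by lia.
have -> : ((2 * (d + n)).+1 - (d + n + n).+1 = d)%N by lia.
set b1 := qbin x _ d; set b2 := qbin x _ (d + n + n).+1.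
have e1 : x ^+ 'C(d, 2) * x ^+ ((d + n) * (d + n + n)) =
    x ^+ ('C(d + n, 2) + (d + n) * (d + n)) * x ^+ 'C(n.+1, 2).
  by rewrite -!exprD jacobi_exponent_low.
(* For d = 0 the exponents need not agree, but the multiplicity [d] makes both sides zero. *)
have e2 : x ^+ 'C((d + n + n).+1, 2) * x ^+ ((d + n) * d.-1) *+ d =
    x ^+ ('C(d + n, 2) + (d + n) * (d + n)) * x ^+ 'C(n.+1, 2) *+ d.
  case: (d) => [|d']; first by rewrite !mulr0n.
  by rewrite -!exprD jacobi_exponent_high.
have s1 : (-1) ^+ d = (-1) ^+ (d + n) * (-1) ^+ n :> A.
  by rewrite exprD -mulrA -expr2 sqrr_sign mulr1.
have s2 : (-1) ^+ (d + n + n).+1 = - ((-1) ^+ (d + n) * (-1) ^+ n) :> A.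
  by rewrite exprS mulN1r (exprD _ (d + n)).
transitivity ((-1) ^+ d * (x ^+ 'C(d, 2) *
    x ^+ ((d + n) * (d + n + n))) * b1 * (d + n + n).+1%:R +
  (-1) ^+ (d + n + n).+1 *
   (x ^+ 'C((d + n + n).+1, 2) * x ^+ ((d + n) * d.-1) *+ d) * b2).
  by ring.
by rewrite s1 s2 e1 e2; ring.
Qed.

End FiniteJacobi.

(** * The Euler product, its cube and its norm *)

Definition euler : series int := fun n => p_coef 1 n.

Lemma euler_congq N : congq N.+1 euler (ofp (qpoch 'X N)).
Proof.
by move=> n nN; rewrite /euler -(@p_coefE 1 n N) //.
Qed.

Lemma euler_congqW N M : (N <= M.+1)%N -> congq N euler (ofp (qpoch 'X M)).
Proof. move=> NM; exact: (congqW NM (@euler_congq M)). Qed.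

Lemma euler_expE j n : (euler ^+ j) n = p_coef j n.
Proof.
rewrite (congqX j (@euler_congq n) (ltnSn n)) -rmorphXn /= /ofp /p_coef /qpoch.
by rewrite prodrXl.
Qed.

Lemma euler_inv : exists d, euler * d = 1.
Proof. by apply: series_inv; rewrite /euler /p_coef big_geq // coef1. Qed.

(** In [qbin_qpoch] all three [qpoch] factors agree with [euler] modulo q^L, so the Gaussian
    binomial becomes the inverse of [euler]. *)
Lemma euler_qbin_congq L k l : (L <= k)%N -> (L <= l)%N ->
  congq L (euler * ofp (qbin 'X (k + l) k)) 1.
Proof.
move=> Lk Ll; have [d ed] := euler_inv.
have step : congq L (euler * euler * ofp (qbin 'X (k + l) k)) euler.
  have E N : (L <= N)%N -> congq L euler (ofp (qpoch 'X N)).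
    by move=> LN; apply: euler_congqW; lia.
  apply: congq_trans (congq_sym (E (k + l)%N _)); last by lia.
  rewrite -qbin_qpoch !rmorphM.
  by apply: congqM (congq_refl _); apply: congqM; apply: E.
have := congqM step (congq_refl d).
rewrite ed.
by have -> : euler * euler * ofp (qbin 'X (k + l) k) * d =
  euler * ofp (qbin 'X (k + l) k) * (euler * d); [ring | rewrite ed mulr1].
Qed.

Definition jacobi M : series int :=
  \sum_(0 <= n < M) (-1) ^+ n * (2 * n).+1%:R * q ^+ 'C(n.+1, 2).

Lemma finite_jacobi m :
  qpoch 'X m ^+ 2 = \sum_(0 <= n < m.+1)
    (-1) ^+ n * 'X^('C(n.+1, 2)) *
     ((m + n).+1%:R * qbin 'X (2 * m).+1 (m - n) -
      (m - n)%:R * qbin 'X (2 * m).+1 (m + n).+1) :> {poly int}.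
Proof.
apply: (mulfI (_ : 'X^('C(m, 2) + m * m) != 0)) (finite_jacobi_scaled 'X m).
by rewrite -size_poly_eq0 size_polyXn.
Qed.

(** Multiply the finite identity by [euler]. For n <= L both Gaussian binomials turn into 1 and the
    weights leave (m + n + 1) - (m - n) = 2n + 1; for n > L the power of q is already at least L. *)
Lemma jacobi_congq L : congq L (euler ^+ 3) (jacobi (2 * L).+1).
Proof.
(* This choice ensures m - n >= L for n <= L, as [euler_qbin_congq] requires. *)
set m := (2 * L)%N.
have -> : euler ^+ 3 = euler * euler ^+ 2 by rewrite exprS.
have Em : congq L euler (ofp (qpoch 'X m)) by apply: euler_congqW; lia.
apply: congq_trans (congqM (congq_refl _) (congqX 2 Em)) _.
rewrite -rmorphXn finite_jacobi rmorph_sum mulr_sumr /jacobi !big_mkord.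
apply: congq_sum => -[n /= nm].
have [nL|Ln] := leqP n L; last first.
  have le : (L <= 'C(n.+1, 2))%N by rewrite bin2S; lia.
  rewrite !rmorphM /= -q_expE.
  set a := ofp _; set b := ofp _.
  have -> : euler * (a * q ^+ 'C(n.+1, 2) * b) = q ^+ 'C(n.+1, 2) * (euler * a * b).
    by ring.
  rewrite [X in congq _ _ X]mulrC.
  by move=> j jL; rewrite !coef_qM !ifT //; lia.
rewrite !(rmorphM, rmorphB, rmorph_sign, rmorph_nat) /= -q_expE.
set s := (-1) ^+ n; set x := q ^+ _; set b1 := ofp _; set b2 := ofp _.
have -> : euler * (s * x * ((m + n).+1%:R * b1 - (m - n)%:R * b2)) =
  s * x * ((m + n).+1%:R * (euler * b1) - (m - n)%:R * (euler * b2)).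
  by ring.
have -> : s * (2 * n).+1%:R * x = s * x * ((m + n).+1%:R * 1 - (m - n)%:R * 1).
  have -> : (m + n).+1 = ((2 * n).+1 + (m - n))%N by lia.
  by rewrite natrD; ring.
have b1E : congq L (euler * b1) 1.
  rewrite /b1; have -> : ((2 * m).+1 = (m - n) + (m + n).+1)%N by lia.
  by apply: euler_qbin_congq; lia.
have b2E : congq L (euler * b2) 1.
  rewrite /b2; have -> : ((2 * m).+1 = (m + n).+1 + (m - n))%N by lia.
  by apply: euler_qbin_congq; lia.
by apply: congqM (congq_refl _) _; apply: congqB; apply: congqM.
Qed.

Lemma binSS2_mod3 n :
  ('C((3 * n + 1).+1, 2) = 3 * (3 * 'C(n.+1, 2)) + 1)%N /\
  (exists x, 'C((3 * n).+1, 2) = 3 * x)%N /\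
  (exists x, 'C((3 * n + 2).+1, 2) = 3 * x)%N.
Proof.
have n2 j : ('C(j.+1, 2) * 2 = j * j + j)%N.
  by elim: j => // j; rewrite [in 'C(j.+2, 2)]bin2S; lia.
split; first by have := n2 (3 * n + 1)%N; have := n2 n; nia.
split.
  exists (('C((3 * n).+1, 2)) %/ 3)%N.
  have := n2 (3 * n)%N; nia.
exists (('C((3 * n + 2).+1, 2)) %/ 3)%N.
have := n2 (3 * n + 2)%N; nia.
Qed.

Lemma U_q j r : (r < 3)%N ->
  U r (q ^+ (3 * j + r)) = q ^+ j :> series int.
Proof.
by move=> r3; rewrite addnC exprD exprM -phi_q -(rmorphXn (@phi _)) /= U_qphi // eqxx.
Qed.

Lemma U_q_neq j r s : (r < 3)%N -> (s < 3)%N -> r != s ->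
  U r (q ^+ (3 * j + s)) = 0 :> series int.
Proof.
move=> r3 s3 rs; rewrite addnC exprD exprM -phi_q -(rmorphXn (@phi _)) /= U_qphi //.
by rewrite (negbTE rs).
Qed.

(** In each block of three terms only the index 3n + 1 contributes to [U 1]: there 2(3n + 1) + 1 =
    3(2n + 1), the sign is -(-1)^n, and the new exponent is 3 times a triangular number, whence
    [phi]. No triangular number is 2 modulo 3. *)
Lemma U_jacobi M :
  U 1 (jacobi (3 * M)) = - 3%:R * phi (jacobi M) /\ U 2 (jacobi (3 * M)) = 0.
Proof.
have scal r n (f : series int) : (r < 3)%N ->
    U r ((-1) ^+ n * (2 * n).+1%:R * f) = (-1) ^+ n * (2 * n).+1%:R * U r f.
  move=> r3; rewrite -[in RHS](U_phiM _ _ r3) rmorphM rmorph_sign rmorph_nat.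
  by [].
rewrite /jacobi; elim: M => [|M [IH1 IH2]].
  by rewrite !big_geq // !raddf0 mulr0.
have -> : (3 * M.+1 = (3 * M).+3)%N by lia.
rewrite !big_nat_recr //= !raddfD /= IH1 IH2 !scal //.
have [E1 [[a Ea] [b Eb]]] := binSS2_mod3 M.
rewrite addn1 in E1; rewrite addn2 in Eb.
rewrite Ea E1 Eb -[(3 * a)%N]addn0 -[(3 * b)%N]addn0.
rewrite !(U_q _ (isT : 1 < 3)%N) !U_q_neq //.
rewrite !(mulr0, addr0, add0r); split=> //.
rewrite 2!rmorphM rmorph_sign rmorph_nat (rmorphXn (@phi _)) /= phi_q -exprM.
have -> : ((2 * (3 * M).+1).+1 = 3 * (2 * M).+1)%N by lia.
have -> : (-1) ^+ (3 * M).+1 = - (-1) ^+ M :> series int.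
  by rewrite exprS mulN1r exprM (_ : (-1) ^+ 3 = -1) //; ring.
by rewrite natrM; ring.
Qed.

Lemma jacobi_stable L M k : (L <= M)%N -> congq L (jacobi (k + M)) (jacobi M).
Proof.
move=> LM; elim: k => [|k IH] //; rewrite addSn.
move=> n nL; rewrite /jacobi big_nat_recr //= series_coefD -/(jacobi _) IH //.
by rewrite mulrC coef_qM ifT ?addr0 // bin2S; lia.
Qed.

Lemma euler_jacobi_congq L M : ((2 * L).+1 <= M)%N ->
  congq L (euler ^+ 3) (jacobi M).
Proof.
move=> LM; apply: congq_trans (@jacobi_congq L) (congq_sym _).
by rewrite -(subnK LM); apply: jacobi_stable; lia.
Qed.

Lemma euler_cube_dissection : exists P,
  euler ^+ 3 = phi P - 3%:R * q * phi (phi euler ^+ 3).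
Proof.
(* [U r] divides the precision by 3, so the cube is approximated modulo q^(3L), by whole blocks of
   three terms. *)
pose M L := (2 * (3 * L)).+1.
have J L : congq (3 * L) (euler ^+ 3) (jacobi (3 * M L)).
  by apply: euler_jacobi_congq; rewrite /M; lia.
have [U1 U2] : U 1 (euler ^+ 3) = - 3%:R * phi (euler ^+ 3) /\
               U 2 (euler ^+ 3) = 0.
  split; apply: congqP => L.
    apply: congq_trans (U_congq (isT : 1 < 3)%N (J L)) _.
    rewrite (U_jacobi _).1; apply: congqM (congq_refl _) _.
    apply: congqW (phi_congq (congq_sym (euler_jacobi_congq _))); first exact: leq_pmull.
    by rewrite /M; lia.
  by apply: congq_trans (U_congq (isT : 2 < 3)%N (J L)) _; rewrite (U_jacobi _).2.
exists (U 0 (euler ^+ 3)).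
rewrite [LHS]dissection U1 U2 !(rmorphM, rmorphN, rmorph0, rmorph_nat) /=.
by ring.
Qed.

(* [euler] is the limit of [qpoch 'X N], whose norm is computed factor by
   factor: [1 - q ^ n] has norm [1 - q ^ n], or [(1 - q ^ (n / 3)) ^ 3] when 3
   divides [n]. *)
Lemma norm3_euler : phi euler * norm3 euler = euler ^+ 4.
Proof.
pose Q N : series int := ofp (qpoch 'X N).
have QS N : Q N.+1 = Q N * (1 - q ^+ N.+1).
  by rewrite /Q qpochS rmorphM rmorphB rmorph1 /= -q_expE.
have Q0 : Q 0 = 1 by rewrite /Q qpoch0 rmorph1.
have N3 n : norm3 (1 - q ^+ (3 * n)) = (1 - q ^+ n) ^+ 3 :> series int.
  have -> : 1 - q ^+ (3 * n) =
      phi (1 - q ^+ n) + q * phi 0 + q ^+ 2 * phi 0 :> series int.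
    by rewrite rmorphB rmorph1 rmorph0 (rmorphXn (@phi _)) /= phi_q -exprM; ring.
  by rewrite norm3E; ring.
have N1 n : norm3 (1 - q ^+ (3 * n + 1)) = 1 - q ^+ (3 * n + 1) :> series int.
  have E : 1 - q ^+ (3 * n + 1) =
      phi 1 + q * phi (- q ^+ n) + q ^+ 2 * phi 0 :> series int.
    rewrite rmorphN rmorph1 rmorph0 (rmorphXn (@phi _)) /= phi_q -exprM exprD.
    by ring.
  by rewrite [in LHS]E norm3E exprD mulnC exprM; ring.
have N2 n : norm3 (1 - q ^+ (3 * n + 2)) = 1 - q ^+ (3 * n + 2) :> series int.
  have E : 1 - q ^+ (3 * n + 2) =
      phi 1 + q * phi 0 + q ^+ 2 * phi (- q ^+ n) :> series int.
    rewrite rmorphN rmorph1 rmorph0 (rmorphXn (@phi _)) /= phi_q -exprM exprD.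
    by ring.
  by rewrite [in LHS]E norm3E exprD mulnC exprM; ring.
(* Each block of three factors contains one multiple of 3. Its norm (1 - q^(L+1))^3 goes to
   [Q L ^+ 3], and the new factor of [phi (Q L)] replaces it in [Q (3 * L)]. *)
have fin L : phi (Q L) * norm3 (Q (3 * L)%N) = Q (3 * L)%N * Q L ^+ 3.
  elim: L => [|L IH].
    have := N3 0%N; rewrite muln0 Q0 rmorph1.
    have -> : norm3 1 = 1 :> series int.
      have -> : 1 = phi 1 + q * phi 0 + q ^+ 2 * phi 0 :> series int.
        by rewrite rmorph1 rmorph0; ring.
      by rewrite norm3E rmorph1 rmorph0; ring.
    by move=> _; ring.
  have -> : (3 * L.+1 = (3 * L).+3)%N by lia.
  rewrite 4!QS !norm3M rmorphM /= rmorphB rmorph1 (rmorphXn (@phi _)) /= phi_q -exprM.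
  have := N1 L; have := N2 L; have := N3 L.+1.
  have -> : (3 * L.+1 = (3 * L).+3)%N by lia.
  rewrite addn1 addn2 => -> -> ->.
  set c1 := 1 - q ^+ _; set c2 := 1 - q ^+ _; set c3 := 1 - q ^+ _; set c4 := 1 - q ^+ _.
  transitivity (phi (Q L) * norm3 (Q (3 * L)%N) * c1 * c2 * c4 * c3 ^+ 3).
    by ring.
  by rewrite IH; ring.
apply: congqP => L.
have E N : (L <= N)%N -> congq L euler (Q N).
  by move=> LN; apply: euler_congqW; lia.
have e1 : congq L (phi euler) (phi (Q L)).
  by apply: congqW (phi_congq (E L (leqnn L))); apply: leq_pmull.
have e2 : congq L (norm3 euler) (norm3 (Q (3 * L)%N)).
  by apply: norm3_congq; apply: euler_congqW; lia.
apply: congq_trans (congqM e1 e2) (congq_sym _).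
rewrite fin exprS; apply: congqM; first by apply: E; lia.
by apply: congqX; apply: E.
Qed.

(** * The 3-dissection of powers of the Euler product *)

Section DissectionTable.
Local Open Scope Z_scope.

(* [acoef n l] is the coefficient of [q ^ (3 - (l - 2)) * y ^ (l - 2)] in
   [U 0 (q ^ (9 - j) * z ^ j)], where [j = n - 2]. *)
Fixpoint acoef (n l : nat) : Z :=
  match n with
  | 0%N => nth 0 [:: 243; 6] l
  | 1%N => nth 0 [:: 0; 9] l
  | 2%N => nth 0 [:: 0; 0; 1] l
  | S ((S ((S n0) as n1)) as n2) =>
      (if l is l'.+1 then acoef n0 l' else 0) - 9 * acoef n2 l -
        27 * acoef n1 l
  end.

End DissectionTable.
Arguments acoef : simpl never.

Lemma acoef_rec n l : acoef n.+3 l =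
  (if l is l'.+1 then acoef n l' else 0) - 9%:R * acoef n.+2 l -
  27%:R * acoef n.+1 l.
Proof. by []. Qed.

Definition lin3 (M : nat -> nat -> Z) (v : nat -> Z) (s : nat) : Z :=
  v 0%N * M 0%N s + v 1%N * M 1%N s + v 2%N * M 2%N s.

(* The matrices of the two extraction steps in the bases [x ^ i] and [y ^ i]; the
   rows [s] outside [2 .. 4] are the coefficients that have to cancel. *)
Definition even_odd (k i s : nat) : Z :=
  if (i <= s <= i + 4)%N then acoef (k + 2 - 4 * i) (s - i) else 0.

Definition odd_even (i s : nat) : Z :=
  if (2 <= s + i <= 6)%N then acoef (4 * i + 2) (s + i - 2) else 0.

Definition pad3 (w : nat -> Z) (s : nat) : Z :=
  if (2 <= s <= 4)%N then w (s - 2)%N else 0.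

Lemma expr12 (A : nzRingType) (a : A) : a ^+ 12 = (a ^+ 3) ^+ 4.
Proof. exact: (exprM a 3 4). Qed.

(* With the notation of the header: [e] is E_1, so [phi e] is E_3 and
   [phi (phi e)] is E_9; [d] and [zi] are the inverses of [e] and [z]; [T] is
   written as a series in [q ^ 3] stripped of [phi]. *)
Section Dissection.
Variables (R : comNzRingType) (e d T z zi : series R).
Hypothesis ed : e * d = 1.
Hypothesis zzi : z * zi = 1.
Hypothesis ez : e ^+ 3 = z * phi (phi e) ^+ 3.
Hypothesis zT : z = phi T - 3%:R * q.

Variables x y : series R.
Hypothesis xE : x = (d * phi e) ^+ 12.
Hypothesis yE : y = (e * phi d) ^+ 12.

Hypothesis T3 : T ^+ 3 = y + 27%:R * q.

Let phied : phi e * phi d = 1.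
Proof. by rewrite -rmorphM ed rmorph1. Qed.

Let xy : x * y = 1.
Proof.
have -> : x * y = ((e * d) * (phi e * phi d)) ^+ 12 by rewrite xE yE; ring.
by rewrite ed phied mulr1 expr1n.
Qed.

(** Cube z + 3q = [phi T] and use [T3]; the terms 27 q^3 cancel. *)
Let zcubic : z ^+ 3 = phi y - 9%:R * q * z ^+ 2 - 27%:R * q ^+ 2 * z.
Proof.
have phiyE : phi y = phi T ^+ 3 - 27%:R * q ^+ 3.
  by rewrite -rmorphXn T3 rmorphD rmorphM rmorph_nat /= phi_q; ring.
by rewrite phiyE zT; ring.
Qed.

(** The power of z is n - 2: the shift admits -2, the least value of k - 4i for 3i <= k <= 8. *)
Let G n := U 0 (q ^+ (11 - n) * z ^+ n * zi ^+ 2).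

Let U0q3M (f : series R) : U 0 (q ^+ 3 * f) = q * U 0 f.
Proof. by rewrite -phi_q U_phiM. Qed.

Let U0natM n (f : series R) : U 0 (n%:R * f) = n%:R * U 0 f.
Proof. by rewrite !mulr_natl raddfMn. Qed.

Let Grec n : (n <= 8)%N ->
  q * G n.+3 = y * G n - 9%:R * (q * G n.+2) - 27%:R * (q * G n.+1).
Proof.
move=> n8; rewrite /G -!U0q3M -U_phiM // -!U0natM -!raddfB /=; congr (@U R 0 _).
have -> : (11 - n = (8 - n).+3)%N by lia.
have -> : (11 - n.+1 = (8 - n).+2)%N by lia.
have -> : (11 - n.+2 = (8 - n).+1)%N by lia.
have -> : (11 - n.+3 = 8 - n)%N by lia.
transitivity (q ^+ 3 * (q ^+ (8 - n) * (z ^+ n * z ^+ 3) * zi ^+ 2)).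
  by rewrite -exprD addn3.
by rewrite zcubic !exprS; ring.
Qed.

Let zzi2 : z ^+ 2 * zi ^+ 2 = 1.
Proof. by rewrite -exprMn zzi expr1n. Qed.

Let U0q9 : U 0 (q ^+ 9) = q ^+ 3 :> series R.
Proof.
have -> : q ^+ 9 = phi (q ^+ 3) :> series R by rewrite rmorphXn /= phi_q -exprM.
by rewrite U_phi.
Qed.

Let G2 : G 2 = q ^+ 3.
Proof. by rewrite /G -mulrA zzi2 mulr1 U0q9. Qed.

Let U0T j (f : series R) : (0 < j < 3)%N -> U 0 (q ^+ j * phi f) = 0.
Proof. by case: j => [|[|[|j]]] // _; rewrite U_qphi. Qed.

Let G3 : G 3 = - 3%:R * q ^+ 3.
Proof.
have -> : G 3 = U 0 (q ^+ 3 * (q ^+ 3 * (q ^+ 2 * phi T)) - 3%:R * (q ^+ 9)).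
  rewrite /G; congr (@U R 0 _); transitivity (q ^+ 8 * z * (z ^+ 2 * zi ^+ 2)).
    by ring.
  by rewrite zzi2 zT; ring.
rewrite raddfB /= !U0q3M U0T // U0natM U0q9.
by ring.
Qed.

Let G4 : G 4 = 9%:R * q ^+ 3.
Proof.
have -> : G 4 = U 0 (q ^+ 3 * (q ^+ 3 * (q ^+ 1 * phi (T ^+ 2))) -
    6%:R * (q ^+ 3 * (q ^+ 3 * (q ^+ 2 * phi T))) + 9%:R * q ^+ 9).
  rewrite /G; congr (@U R 0 _).
  transitivity (q ^+ 7 * z ^+ 2 * (z ^+ 2 * zi ^+ 2)); first by ring.
  by rewrite zzi2 zT rmorphXn /=; ring.
rewrite raddfD raddfB /= U0natM !U0q3M !U0T // U0natM U0q9.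
by ring.
Qed.

Let c (t : Z) : series R := (int_of_Z t)%:~R.

Let cD s t : c (s + t) = c s + c t. Proof. by rewrite /c !rmorphD. Qed.
Let cB s t : c (s - t) = c s - c t. Proof. by rewrite /c !rmorphB. Qed.
Let cM s t : c (s * t) = c s * c t. Proof. by rewrite /c !rmorphM. Qed.
Let cn n : c n%:R = n%:R. Proof. by rewrite /c !rmorph_nat. Qed.
Let c0 : c 0 = 0. Proof. by []. Qed.

Let H n : series R := c (acoef n 0) * q ^+ 5 + c (acoef n 1) * q ^+ 4 * y +
  c (acoef n 2) * q ^+ 3 * y ^+ 2 + c (acoef n 3) * q ^+ 2 * y ^+ 3 +
  c (acoef n 4) * q * y ^+ 4.

Let Hrec n : (n <= 7)%N ->
  q * H n.+3 = y * H n - 9%:R * (q * H n.+2) - 27%:R * (q * H n.+1).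
Proof.
(* Otherwise [y * H n] would have a term in y^5, which has no place in [H n.+3]. *)
move=> n7; have a4 : acoef n 4 = 0 by move: n n7; do 8?case=> //.
rewrite /H a4 !acoef_rec !cB !cM !cn !c0.
by ring.
Qed.

(** Both sides obey the same recurrence. The values at 1 and 0 come from running it backwards from
    [G2], [G3] and [G4]; each backward step costs a factor [y], hence the square. *)
Let GH n : (n <= 10)%N -> y ^+ 2 * G n = H n.
Proof.
have H0 : H 0 = 6%:R * q ^+ 4 * y + 243%:R * q ^+ 5.
  by rewrite /H /acoef /= !c0 -[Zpos 243]/(243%:R : Z) -[Zpos 6]/(6%:R : Z) !cn; ring.
have H1 : H 1 = 9%:R * q ^+ 4 * y.
  by rewrite /H /acoef /= !c0 -[Zpos 9]/(9%:R : Z) !cn; ring.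
have H2 : H 2 = q ^+ 3 * y ^+ 2.
  by rewrite /H /acoef /= !c0 -[Zpos 1]/(1%:R : Z) !cn; ring.
have yG1 : y * G 1 = 9%:R * q ^+ 4.
  transitivity (q * G 4 + 9%:R * (q * G 3) + 27%:R * (q * G 2)).
    by rewrite [q * G 4]Grec //; ring.
  by rewrite G2 G3 G4; ring.
have yG0 : y * G 0 = 6%:R * q ^+ 4 + 27%:R * (q * G 1).
  transitivity (q * G 3 + 9%:R * (q * G 2) + 27%:R * (q * G 1)).
    by rewrite [q * G 3]Grec //; ring.
  by rewrite G2 G3; ring.
have [m] := ubnP n; elim: m n => // m IH [|[|[|n]]] nm n10.
- transitivity (y * (y * G 0)); first by ring.
  rewrite yG0 H0; transitivity (6%:R * q ^+ 4 * y + 27%:R * q * (y * G 1)).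
    by ring.
  by rewrite yG1; ring.
- transitivity (y * (y * G 1)); first by ring.
  by rewrite yG1 H1; ring.
- by rewrite G2 H2 mulrC.
apply: (@q_inj _ 1); rewrite expr1 Hrec; last by lia.
transitivity (y ^+ 2 * (q * G n.+3)); first by ring.
rewrite Grec; last by lia.
by rewrite -!IH; try lia; ring.
Qed.

Definition even_comb k (v : nat -> Z) : series R :=
  e ^+ (3 * k) * (c (v 0%N) + c (v 1%N) * q * x + c (v 2%N) * q ^+ 2 * x ^+ 2).

(* Shifted by [q ^ 3], to avoid the negative powers of [q]. *)
Definition odd_comb k (v : nat -> Z) : series R :=
  phi e ^+ (3 * k) *
  (c (v 0%N) * q ^+ 3 + c (v 1%N) * q ^+ 2 * y + c (v 2%N) * q * y ^+ 2).

Let yinj k : injective ( *%R (y ^+ k)).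
Proof.
apply: (can_inj (g := *%R (x ^+ k))) => f.
by rewrite mulrA -exprMn xy expr1n mul1r.
Qed.

Let cU t (f : series R) : U 0 (c t * f) = c t * U 0 f.
Proof. by rewrite /c -[in RHS]U_phiM // rmorph_int. Qed.

Let d3 : d ^+ 3 = zi * phi (phi d) ^+ 3.
Proof.
have gg : phi (phi e) * phi (phi d) = 1 by rewrite -rmorphM phied rmorph1.
transitivity (d ^+ 3 * (z * zi) * (phi (phi e) * phi (phi d)) ^+ 3).
  by rewrite zzi gg expr1n !mulr1.
transitivity (d ^+ 3 * (z * phi (phi e) ^+ 3) * (zi * phi (phi d) ^+ 3)); first by ring.
by rewrite -ez -exprMn (mulrC d) ed expr1n mul1r.
Qed.

Let z_sub k i : (4 * i <= k + 2)%N ->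
  z ^+ k * zi ^+ (4 * i) = z ^+ (k + 2 - 4 * i) * zi ^+ 2.
Proof.
move=> ik; transitivity (z ^+ (k + 2) * zi ^+ 2 * zi ^+ (4 * i)).
  by rewrite exprD -(mulrA (z ^+ k)) zzi2 mulr1.
rewrite -{1}(subnK ik) exprD -mulrA mulrACA -exprMn.
transitivity (z ^+ (k + 2 - 4 * i) * zi ^+ 2 * (z * zi) ^+ (4 * i)).
  by rewrite exprMn; ring.
by rewrite zzi expr1n mulr1.
Qed.

(** Up to a series in q^3, which passes through [U 0], each summand of [even_comb] is a power of q
    times z^(k - 4i). *)
Let expr_e k i : (4 * i <= k + 2)%N -> e ^+ (3 * k) * x ^+ i =
  phi (phi e ^+ (3 * k) * y ^+ i) * (z ^+ (k + 2 - 4 * i) * zi ^+ 2).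
Proof.
move=> ik; rewrite -z_sub // rmorphM !(rmorphXn (@phi R)) /=.
have d12 : d ^+ 12 = (zi * phi (phi d) ^+ 3) ^+ 4 by rewrite expr12 d3.
have phiy : phi y = phi e ^+ 12 * (phi (phi d) ^+ 3) ^+ 4.
  by rewrite yE (rmorphXn (@phi R)) rmorphM /= exprMn (expr12 (phi (phi d))).
rewrite phiy xE (exprMn _ d) d12 exprM ez (exprM (phi (phi e)) 3) (exprM zi 4).
move: (phi (phi e) ^+ 3) (phi (phi d) ^+ 3) (phi e ^+ 12) => F D A.
by rewrite !exprMn; ring.
Qed.

Let U0q3XM i (f : series R) : U 0 (q ^+ (3 * i) * f) = q ^+ i * U 0 f.
Proof. by rewrite exprM -phi_q -(rmorphXn (@phi R)) U_phiM. Qed.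

(** The factor q^(9-k) selects the exponents 3n + k and supplies the shift by q^3 of [odd_comb].
    After multiplication by q^2 y^2 both sides are combinations of the monomials q^(7-s) y^s with s
    < 7, compared row by row. *)
Lemma U_even_comb k v w : (k <= 8)%N ->
  (forall i, (k < 3 * i)%N -> v i = 0) ->
  (forall s, (s < 7)%N -> lin3 (even_odd k) v s = pad3 w s) ->
  U 0 (q ^+ (9 - k) * even_comb k v) = odd_comb k w.
Proof.
move=> k8 v0 vw.
pose t i := U 0 (q ^+ (9 - k) * (e ^+ (3 * k) * (q ^+ i * x ^+ i))).
have tE i : (i < 3)%N -> c (v i) * (q ^+ 2 * (y ^+ 2 * t i)) =
  phi e ^+ (3 * k) * (c (v i) * (q ^+ (2 - i) * y ^+ i * H (k + 2 - 4 * i))).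
  (* In the remaining case 3i <= k and i <= 2 give 4i <= k + 2, so the subtraction is exact. *)
  move=> i3; have [ki|ik] := ltnP k (3 * i); first by rewrite v0 // c0 !mul0r mulr0.
  rewrite [RHS]mulrCA; congr (_ * _); rewrite -GH; last by lia.
  have q2 : q ^+ 2 = q ^+ i * q ^+ (2 - i) :> series R.
    by rewrite -exprD subnKC //; lia.
  transitivity (q ^+ (2 - i) * y ^+ 2 * (q ^+ i * t i)); first by rewrite q2; ring.
  rewrite /t -U0q3XM.
  have -> : q ^+ (3 * i) * (q ^+ (9 - k) * (e ^+ (3 * k) * (q ^+ i * x ^+ i))) =
      phi (phi e ^+ (3 * k) * y ^+ i) *
      (q ^+ (11 - (k + 2 - 4 * i)) * z ^+ (k + 2 - 4 * i) * zi ^+ 2).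
    have -> : (11 - (k + 2 - 4 * i) = 3 * i + (9 - k) + i)%N by lia.
    transitivity (q ^+ (3 * i + (9 - k) + i) * (e ^+ (3 * k) * x ^+ i)).
      by rewrite !exprD; ring.
    rewrite expr_e; last by lia.
    by ring.
  by rewrite U_phiM // -/(G _); ring.
have -> : U 0 (q ^+ (9 - k) * even_comb k v) =
    c (v 0%N) * t 0%N + c (v 1%N) * t 1%N + c (v 2%N) * t 2.
  rewrite /t -!cU -!raddfD /even_comb; congr (@U R 0 _).
  by ring.
apply: (@q_inj _ 2); apply: (@yinj 2).
transitivity (c (v 0%N) * (q ^+ 2 * (y ^+ 2 * t 0%N)) +
  c (v 1%N) * (q ^+ 2 * (y ^+ 2 * t 1%N)) + c (v 2%N) * (q ^+ 2 * (y ^+ 2 * t 2))).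
  by ring.
rewrite !tE // -!mulrDr /odd_comb.
set n0 := (k + 2 - 4 * 0)%N; set n1 := (k + 2 - 4 * 1)%N; set n2 := (k + 2 - 4 * 2)%N.
set F := phi e ^+ _.
transitivity (F * (q ^+ 2 * y ^+ 2 * (c (w 0%N) * q ^+ 3 + c (w 1%N) * q ^+ 2 * y +
  c (w 2%N) * q * y ^+ 2))); last by ring.
congr (_ * _).
have E0 : c (v 0%N) * c (acoef n0 0) + c (v 1%N) * 0 + c (v 2%N) * 0 = 0.
  by rewrite -?c0 -!cM -!cD; congr c; exact: (vw 0%N isT).
have E1 : c (v 0%N) * c (acoef n0 1) + c (v 1%N) * c (acoef n1 0) + c (v 2%N) * 0 = 0.
  by rewrite -?c0 -!cM -!cD; congr c; exact: (vw 1%N isT).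
have E2 :
    c (v 0%N) * c (acoef n0 2) + c (v 1%N) * c (acoef n1 1) +
    c (v 2%N) * c (acoef n2 0) = c (w 0%N).
  by rewrite -?c0 -!cM -!cD; congr c; exact: (vw 2%N isT).
have E3 :
    c (v 0%N) * c (acoef n0 3) + c (v 1%N) * c (acoef n1 2) +
    c (v 2%N) * c (acoef n2 1) = c (w 1%N).
  by rewrite -?c0 -!cM -!cD; congr c; exact: (vw 3%N isT).
have E4 :
    c (v 0%N) * c (acoef n0 4) + c (v 1%N) * c (acoef n1 3) +
    c (v 2%N) * c (acoef n2 2) = c (w 2%N).
  by rewrite -?c0 -!cM -!cD; congr c; exact: (vw 4%N isT).
have E5 : c (v 0%N) * 0 + c (v 1%N) * c (acoef n1 4) + c (v 2%N) * c (acoef n2 3) = 0.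
  by rewrite -?c0 -!cM -!cD; congr c; exact: (vw 5%N isT).
have E6 : c (v 0%N) * 0 + c (v 1%N) * 0 + c (v 2%N) * c (acoef n2 4) = 0.
  by rewrite -?c0 -!cM -!cD; congr c; exact: (vw 6%N isT).
transitivity ((c (v 0%N) * c (acoef n0 0) + c (v 1%N) * 0 + c (v 2%N) * 0) *
    (q ^+ 7 * y ^+ 0) +
  (c (v 0%N) * c (acoef n0 1) + c (v 1%N) * c (acoef n1 0) + c (v 2%N) * 0) *
    (q ^+ 6 * y ^+ 1) +
  (c (v 0%N) * c (acoef n0 2) + c (v 1%N) * c (acoef n1 1) + c (v 2%N) * c (acoef n2 0)) *
    (q ^+ 5 * y ^+ 2) +
  (c (v 0%N) * c (acoef n0 3) + c (v 1%N) * c (acoef n1 2) + c (v 2%N) * c (acoef n2 1)) *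
    (q ^+ 4 * y ^+ 3) +
  (c (v 0%N) * c (acoef n0 4) + c (v 1%N) * c (acoef n1 3) + c (v 2%N) * c (acoef n2 2)) *
    (q ^+ 3 * y ^+ 4) +
  (c (v 0%N) * 0 + c (v 1%N) * c (acoef n1 4) + c (v 2%N) * c (acoef n2 3)) *
    (q ^+ 2 * y ^+ 5) +
  (c (v 0%N) * 0 + c (v 1%N) * 0 + c (v 2%N) * c (acoef n2 4)) * (q ^+ 1 * y ^+ 6)).
  by rewrite /H; ring.
(* [n0], [n1] and [n2] are made abstract because distinct [acoef]s can be
   convertible. *)
by clearbody n0 n1 n2; rewrite E0 E1 E2 E3 E4 E5 E6; ring.
Qed.

(** Here y^i is z^(4i) times a series in q^3. After multiplication by q^2 y^4 the monomials are
    again q^(7-s) y^s; since x y = 1, the power x^j becomes y^(4-j), which reverses the order of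
    [w]. *)
Lemma U_odd_comb k v w :
  (forall s, (s < 7)%N ->
     lin3 odd_even v s = pad3 (fun j => w (2 - j)%N) s) ->
  U 0 (odd_comb k v) = q * even_comb k w.
Proof.
move=> vw.
pose t i := U 0 (phi e ^+ (3 * k) * (q ^+ (3 - i) * y ^+ i)).
have tE i : (i < 3)%N -> q ^+ 2 * (y ^+ 4 * t i) =
  e ^+ (3 * k) * (q ^+ i * y ^+ (2 - i) * H (4 * i + 2)).
  move=> i3; rewrite -GH; last by lia.
  have tiE : q ^+ (2 - i) * t i = e ^+ (3 * k) * x ^+ i * G (4 * i + 2).
    rewrite /t -U0q3XM -U_phiM //; congr (@U R 0 _).
    have -> : (11 - (4 * i + 2) = 3 * (2 - i) + (3 - i))%N by lia.
    have yi : y ^+ i = z ^+ (4 * i) * phi (x ^+ i).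
      rewrite (rmorphXn (@phi R)) /= (exprM z 4) -exprMn; congr (_ ^+ i).
      rewrite xE yE (rmorphXn (@phi R)) rmorphM /= !(exprMn 12).
      have -> : e ^+ 12 = (z * phi (phi e) ^+ 3) ^+ 4 by rewrite expr12 ez.
      have -> : phi (phi e) ^+ 12 = (phi (phi e) ^+ 3) ^+ 4 by rewrite expr12.
      move: (phi (phi e) ^+ 3) (phi d ^+ 12) => F D.
      by rewrite exprMn; ring.
    rewrite yi rmorphM (rmorphXn (@phi R) (3 * k)) /=.
    rewrite (exprD q (3 * (2 - i)) (3 - i)) (exprD z (4 * i) 2).
    transitivity (q ^+ (3 * (2 - i)) * q ^+ (3 - i) * phi e ^+ (3 * k) *
      phi (x ^+ i) * z ^+ (4 * i) * (z ^+ 2 * zi ^+ 2)); last by ring.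
    by rewrite zzi2; ring.
  have q2 : q ^+ 2 = q ^+ i * q ^+ (2 - i) :> series R.
    by rewrite -exprD subnKC //; lia.
  have y4 : y ^+ 4 * x ^+ i = y ^+ (2 - i) * y ^+ 2.
    rewrite -exprD (_ : 4 = (2 - i + 2) + i)%N; last by lia.
    by rewrite exprD -mulrA -exprMn (mulrC y) xy expr1n mulr1.
  transitivity (q ^+ i * y ^+ 4 * (q ^+ (2 - i) * t i)); first by rewrite q2; ring.
  rewrite tiE.
  transitivity (q ^+ i * e ^+ (3 * k) * G (4 * i + 2) * (y ^+ 4 * x ^+ i)).
    by ring.
  by rewrite y4; ring.
have -> : U 0 (odd_comb k v) =
    c (v 0%N) * t 0%N + c (v 1%N) * t 1%N + c (v 2%N) * t 2.
  rewrite /t -!cU -!raddfD /odd_comb; congr (@U R 0 _).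
  by ring.
apply: (@q_inj _ 2); apply: (@yinj 4).
transitivity (c (v 0%N) * (q ^+ 2 * (y ^+ 4 * t 0%N)) +
  c (v 1%N) * (q ^+ 2 * (y ^+ 4 * t 1%N)) + c (v 2%N) * (q ^+ 2 * (y ^+ 4 * t 2))).
  by ring.
rewrite !tE // /even_comb.
set n0 := (4 * 0 + 2)%N; set n1 := (4 * 1 + 2)%N; set n2 := (4 * 2 + 2)%N.
set F := e ^+ _.
transitivity (F * (c (v 0%N) * (y ^+ 2 * H n0) + c (v 1%N) * (q * y * H n1) +
  c (v 2%N) * (q ^+ 2 * H n2))); first by ring.
transitivity (F * (c (w 0%N) * q ^+ 3 * y ^+ 4 + c (w 1%N) * q ^+ 4 * y ^+ 3 * (x * y) +
  c (w 2%N) * q ^+ 5 * y ^+ 2 * (x * y) ^+ 2)); last by ring.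
rewrite xy expr1n !mulr1; congr (_ * _).
have E0 : c (v 0%N) * 0 + c (v 1%N) * 0 + c (v 2%N) * c (acoef n2 0) = 0.
  by rewrite -?c0 -!cM -!cD; congr c; exact: (vw 0%N isT).
have E1 : c (v 0%N) * 0 + c (v 1%N) * c (acoef n1 0) + c (v 2%N) * c (acoef n2 1) = 0.
  by rewrite -?c0 -!cM -!cD; congr c; exact: (vw 1%N isT).
have E2 :
    c (v 0%N) * c (acoef n0 0) + c (v 1%N) * c (acoef n1 1) +
    c (v 2%N) * c (acoef n2 2) = c (w 2%N).
  by rewrite -?c0 -!cM -!cD; congr c; exact: (vw 2%N isT).
have E3 :
    c (v 0%N) * c (acoef n0 1) + c (v 1%N) * c (acoef n1 2) +
    c (v 2%N) * c (acoef n2 3) = c (w 1%N).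
  by rewrite -?c0 -!cM -!cD; congr c; exact: (vw 3%N isT).
have E4 :
    c (v 0%N) * c (acoef n0 2) + c (v 1%N) * c (acoef n1 3) +
    c (v 2%N) * c (acoef n2 4) = c (w 0%N).
  by rewrite -?c0 -!cM -!cD; congr c; exact: (vw 4%N isT).
have E5 : c (v 0%N) * c (acoef n0 3) + c (v 1%N) * c (acoef n1 4) + c (v 2%N) * 0 = 0.
  by rewrite -?c0 -!cM -!cD; congr c; exact: (vw 5%N isT).
have E6 : c (v 0%N) * c (acoef n0 4) + c (v 1%N) * 0 + c (v 2%N) * 0 = 0.
  by rewrite -?c0 -!cM -!cD; congr c; exact: (vw 6%N isT).
transitivity ((c (v 0%N) * 0 + c (v 1%N) * 0 + c (v 2%N) * c (acoef n2 0)) *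
    (q ^+ 7 * y ^+ 0) +
  (c (v 0%N) * 0 + c (v 1%N) * c (acoef n1 0) + c (v 2%N) * c (acoef n2 1)) *
    (q ^+ 6 * y ^+ 1) +
  (c (v 0%N) * c (acoef n0 0) + c (v 1%N) * c (acoef n1 1) + c (v 2%N) * c (acoef n2 2)) *
    (q ^+ 5 * y ^+ 2) +
  (c (v 0%N) * c (acoef n0 1) + c (v 1%N) * c (acoef n1 2) + c (v 2%N) * c (acoef n2 3)) *
    (q ^+ 4 * y ^+ 3) +
  (c (v 0%N) * c (acoef n0 2) + c (v 1%N) * c (acoef n1 3) + c (v 2%N) * c (acoef n2 4)) *
    (q ^+ 3 * y ^+ 4) +
  (c (v 0%N) * c (acoef n0 3) + c (v 1%N) * c (acoef n1 4) + c (v 2%N) * 0) *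
    (q ^+ 2 * y ^+ 5) +
  (c (v 0%N) * c (acoef n0 4) + c (v 1%N) * 0 + c (v 2%N) * 0) * (q ^+ 1 * y ^+ 6)).
  by rewrite /H; ring.
by clearbody n0 n1 n2; rewrite E0 E1 E2 E3 E4 E5 E6; ring.
Qed.

End Dissection.

(** * The coefficient sequences *)

Definition vec (k b i : nat) : Z := if i is 0%N then C_Z k b else D_Z k i b.

Lemma C_ZE (k b : nat) :
  C_Z k b.+4 = (h_coef k * C_Z k b.+2 + r_coef k * C_Z k b)%R.
Proof. by do 9?[case: k => [|k] //]. Qed.

Lemma vec_rec k b i :
  vec k b.+4 i = h_coef k * vec k b.+2 i + r_coef k * vec k b i.
Proof. by case: i => [|i]; rewrite /vec ?C_ZE ?D_ZE. Qed.

Lemma rec4_0 h r b : rec4 h r 0 0 0 0 b = 0.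
Proof.
have [n] := ubnP b; elim: n b => // n IH [|[|[|[|b]]]] // bn.
have -> : rec4 h r 0 0 0 0 b.+4 = h * rec4 h r 0 0 0 0 b.+2 + r * rec4 h r 0 0 0 0 b.
  by [].
by rewrite !IH ?mulr0 ?addr0 //; lia.
Qed.

Lemma vec_eq0 k b i : (k <= 8)%N -> (k < 3 * i)%N -> vec k b i = 0.
Proof.
case: i => [|i]; first by rewrite muln0.
move=> k8 ki; transitivity (rec4 (h_coef k) (r_coef k) 0 0 0 0 b); last exact: rec4_0.
by move: k8 ki; do 9?[case: k => [|k] //]; case: i => [|[|i]].
Qed.

Lemma vec_0 k i : (1 <= k <= 8)%N -> vec k 0 i = (i == 0%N)%:R.
Proof.
case: i => [|i]; first by do 9?[case: k => [|k] //].
by move=> _; do 9?[case: k => [|k] //]; case: i => [|[|i]].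
Qed.

Lemma lin3_rec M k b s : lin3 M (vec k b.+4) s =
  h_coef k * lin3 M (vec k b.+2) s + r_coef k * lin3 M (vec k b) s.
Proof. by rewrite /lin3 !vec_rec; ring. Qed.

Lemma pad3_rec g k b s : pad3 (vec k b.+4 \o g) s =
  h_coef k * pad3 (vec k b.+2 \o g) s + r_coef k * pad3 (vec k b \o g) s.
Proof. by rewrite /pad3 /= vec_rec; case: ifP => //; rewrite !mulr0 addr0. Qed.

Definition step_check (M : nat -> nat -> nat -> Z) (g : nat -> nat) (b : nat) :=
  all (fun k => all (fun s =>
    Z.eqb (lin3 (M k) (vec k b) s) (pad3 (vec k b.+1 \o g) s)) (iota 0 7))
    (iota 1 8).

(** Both sides are linear in the tables and inherit their recurrence, so two consecutive indices of
    one parity suffice. *)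
Lemma step_rec M g b0 : step_check M g b0 -> step_check M g b0.+2 ->
  forall b k s, (1 <= k <= 8)%N -> (s < 7)%N ->
  lin3 (M k) (vec k (2 * b + b0)) s = pad3 (vec k (2 * b + b0).+1 \o g) s.
Proof.
move=> c0 c2 b k s k8 s7.
have ck b' : step_check M g b' ->
    lin3 (M k) (vec k b') s = pad3 (vec k b'.+1 \o g) s.
  move=> /allP/(_ k); rewrite mem_iota => /(_ k8) /allP/(_ s).
  by rewrite mem_iota => /(_ s7) /Z.eqb_eq.
have [] : lin3 (M k) (vec k (2 * b + b0)) s = pad3 (vec k (2 * b + b0).+1 \o g) s /\
  lin3 (M k) (vec k (2 * b + b0).+2) s = pad3 (vec k (2 * b + b0).+3 \o g) s => //.
elim: b => [|b [IH1 IH2]]; first by split; apply: ck.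
have -> : (2 * b.+1 + b0 = (2 * b + b0).+2)%N by lia.
by split=> //; rewrite lin3_rec pad3_rec IH1 IH2.
Qed.

Lemma even_step b k s : (1 <= k <= 8)%N -> (s < 7)%N ->
  lin3 (even_odd k) (vec k (2 * b)) s = pad3 (vec k (2 * b).+1) s.
Proof.
move=> k8 s7; have := @step_rec even_odd id 0 _ _ b k s k8 s7.
by rewrite addn0; apply; vm_compute.
Qed.

Lemma odd_step b k s : (1 <= k <= 8)%N -> (s < 7)%N ->
  lin3 odd_even (vec k (2 * b).+1) s =
  pad3 (fun j => vec k (2 * b.+1) (2 - j)) s.
Proof.
move=> k8 s7; have := @step_rec (fun=> odd_even) (fun j => 2 - j)%N 1 _ _ b k s k8 s7.
have [-> ->] : (2 * b).+1 = (2 * b + 1)%N /\ (2 * b.+1 = (2 * b + 1).+1)%N by lia.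
by apply; vm_compute.
Qed.

(** With P the part of E_1^3 in powers of q^3, the norm of E_1^3 is computed from its dissection and
    by multiplicativity, which determines P^3. Then z = E_1^3 / E_9^3, and [T] is P divided by
    [phi euler ^+ 3]. *)
Lemma euler_parametrization : exists d T z zi,
  [/\ euler * d = 1, z * zi = 1, euler ^+ 3 = z * phi (phi euler) ^+ 3,
      z = phi T - 3%:R * q & T ^+ 3 = (euler * phi d) ^+ 12 + 27%:R * q].
Proof.
have [d ed] := euler_inv; have [P eP] := euler_cube_dissection.
have fd : phi euler * phi d = 1 by rewrite -rmorphM ed rmorph1.
have gd : phi (phi euler) * phi (phi d) = 1 by rewrite -rmorphM fd rmorph1.
have P3 : P ^+ 3 = euler ^+ 12 * phi d ^+ 3 + 27%:R * q * phi euler ^+ 9.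
  have nE : norm3 euler = euler ^+ 4 * phi d.
    by rewrite -norm3_euler mulrAC fd mul1r.
  have : norm3 (euler ^+ 3) = (euler ^+ 4 * phi d) ^+ 3.
    by rewrite -nE !exprS expr0 !mulr1 !norm3M.
  have -> : euler ^+ 3 = phi P + q * phi (- 3%:R * phi euler ^+ 3) + q ^+ 2 * phi 0.
    by rewrite eP !(rmorphXn (@phi _), rmorphM, rmorphN, rmorph_nat, rmorph0) /=; ring.
  rewrite norm3E => nP.
  transitivity ((euler ^+ 4 * phi d) ^+ 3 + 27%:R * q * phi euler ^+ 9).
    by rewrite -nP; ring.
  by rewrite exprMn -exprM.
exists d, (P * phi d ^+ 3), (euler ^+ 3 * phi (phi d) ^+ 3),
  (d ^+ 3 * phi (phi euler) ^+ 3); split=> //.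
- transitivity ((euler * d) ^+ 3 * (phi (phi euler) * phi (phi d)) ^+ 3).
    by ring.
  by rewrite ed gd !expr1n mulr1.
- transitivity (euler ^+ 3 * (phi (phi euler) * phi (phi d)) ^+ 3); last by ring.
  by rewrite gd expr1n mulr1.
- rewrite rmorphM !(rmorphXn (@phi _)) /= eP.
  transitivity (phi P * phi (phi d) ^+ 3 -
    3%:R * q * (phi (phi euler) * phi (phi d)) ^+ 3).
    by rewrite (rmorphXn (@phi _)) /=; ring.
  by rewrite gd expr1n mulr1.
transitivity (euler ^+ 12 * phi d ^+ 12 +
  27%:R * q * (phi euler * phi d) ^+ 9).
  by rewrite exprMn P3; ring.
by rewrite fd expr1n mulr1 exprMn.
Qed.

(** * Iterated extraction and the congruences *)

Definition tri (x : nat) : nat := ((3 ^ (2 * x) - 1) %/ 8)%N.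

Lemma triE x : (8 * tri x + 1 = 3 ^ (2 * x))%N.
Proof. exact: sqr_index_exact. Qed.

(** Extracting the exponents 3n + k and then 3n sends n to 9n + k; b such pairs send 0 to
    [k * tri b]. This composes the offsets. *)
Lemma triD x x' : tri (x + x') = (3 ^ (2 * x) * tri x' + tri x)%N.
Proof.
have := triE (x + x'); rewrite mulnDr expnD -(triE x) -(triE x').
by nia.
Qed.

Lemma p_coef_odd k b : (1 <= k <= 8)%N -> exists y : series int,
  forall n, p_coef (3 * k) (3 ^ (2 * b).+1 * n + k * tri b.+1) =
    odd_comb euler y k (vec k (2 * b).+1) (n + 3)%N.
Proof.
move=> k18; have /andP[_ k8] := k18.
have [d [T [z [zi [ed zzi ez zT T3]]]]] := euler_parametrization.
set x := (d * phi euler) ^+ 12; set y := (euler * phi d) ^+ 12 in T3.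
have UE := U_even_comb ed zzi ez zT (erefl x) (erefl y) T3 k8.
have UO := U_odd_comb ed zzi ez zT (erefl x) (erefl y) T3.
have even_odd b' : (forall n, p_coef (3 * k) (3 ^ (2 * b') * n + k * tri b') =
    even_comb euler x k (vec k (2 * b')) n) ->
  forall n, p_coef (3 * k) (3 ^ (2 * b').+1 * n + k * tri b'.+1) =
    odd_comb euler y k (vec k (2 * b').+1) (n + 3)%N.
  move=> E n; rewrite -(UE (vec k (2 * b'))); first last.
  - by move=> s s7; apply: even_step.
  - by move=> i; apply: vec_eq0.
  rewrite /U addn0 coef_qM ifF; last by lia.
  have -> : (3 * (n + 3) - (9 - k) = 3 * n + k)%N by lia.
  rewrite -E; congr (p_coef _ _).
  by rewrite -(addn1 b') triD (_ : tri 1 = 1%N) // muln1 expnS; lia.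
exists y; elim: b => [|b IH]; apply: even_odd => n.
  rewrite /even_comb !vec_0 // !rmorph0 !rmorph1 !mul0r !addr0 mulr1 euler_expE.
  by rewrite mul1n muln0 addn0.
have : (q ^+ 1 * even_comb euler x k (vec k (2 * b.+1))) n.+1 =
       even_comb euler x k (vec k (2 * b.+1)) n.
  by rewrite coef_qM subn1.
rewrite expr1 -(UO k (vec k (2 * b).+1)); last by move=> s; apply: odd_step.
(* The factor q in [U_odd_comb] raises n by one, and tripling turns this into the shift by 3 in
   [odd_comb]. *)
move=> <-; rewrite /U addn0 (_ : 3 * n.+1 = 3 * n + 3)%N; last by lia.
rewrite -IH; congr (p_coef _ _).
have -> : (2 * b.+1 = (2 * b).+2)%N by lia.
by rewrite [in LHS]expnSr mulnA.
Qed.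

(** The coefficients with index 1 <= i <= k/3 are multiples of m and those beyond are zero, so only
    the [C] term survives modulo m; [S] collects the rest. *)
Lemma p_coef_odd_modn (m k b : nat) : (1 <= k <= 8)%N -> D_vanish m k b.+1 ->
  exists S : series int, forall n,
  p_coef (3 * k) (3 ^ (2 * b).+1 * n + k * tri b.+1) =
    C k (2 * b).+1 * phi (euler ^+ (3 * k)) n + m%:Z * S n.
Proof.
move=> k18 /andP[_ /allP D0]; have /andP[_ k8] := k18.
have dvd i : (0 < i)%N ->
    exists a : series int, (int_of_Z (vec k (2 * b).+1 i))%:~R = m%:R * a.
  move=> i0; have [ki|ik] := ltnP k (3 * i).
    by exists 0; rewrite vec_eq0 // mulr0.
  have /D0 /dvdzP[a aE] : i \in iota 1 (k %/ 3) by rewrite mem_iota; lia.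
  exists a%:~R; rewrite mulrC [m%:R]pmulrn -intrM -aE /D; case: i i0 {ik aE} => // i _.
  by congr (int_of_Z (D_Z _ _ _))%:~R; lia.
have [a1 E1] := dvd 1%N isT; have [a2 E2] := dvd 2%N isT.
have [y yE] := p_coef_odd b k18.
exists (fun n => (phi euler ^+ (3 * k) * (a1 * q ^+ 2 * y + a2 * q * y ^+ 2))
  (n + 3)%N) => n.
have coef_intM (c : int) (f : series int) j : c * f j = (c%:~R * f) j.
  by rewrite coef_intrM intz.
have shift (f : series int) : f n = (q ^+ 3 * f) (n + 3)%N.
  by rewrite coef_qM ifF ?addnK //; lia.
rewrite yE /odd_comb E1 E2 -/(C k _) [phi _ n]shift.
rewrite (coef_intM (C _ _)) (coef_intM m%:Z) -series_coefD -pmulrn.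
(* On an equation in [nat -> int], [ring] would use the pointwise product. *)
apply: (congr1 (fun f : series int => f (n + 3)%N)).
by rewrite (rmorphXn (@phi _)) /=; ring.
Qed.

(** The coefficient of [phi (euler ^+ (3 * k))] at 3N is again the coefficient of [euler ^+ (3 * k)]
    at N, so each further round contributes one factor [c]. *)
Lemma p_coef_modn_iter (m k b : nat) : (1 <= k <= 8)%N -> D_vanish m k b.+1 ->
  forall j n, (1 <= j)%N ->
  (m %| p_coef (3 * k) (3 ^ (2 * b.+1 * j - 1) * n + k * tri (b.+1 * j)) -
        (C k (2 * b).+1 %% m)%Z ^+ j * phi (euler ^+ (3 * k)) n)%Z.
Proof.
move=> k18 Db; set c := (_ %% m)%Z.
have step n : (m %| p_coef (3 * k) (3 ^ (2 * b).+1 * n + k * tri b.+1) -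
    c * phi (euler ^+ (3 * k)) n)%Z.
  have [S ->] := p_coef_odd_modn k18 Db.
  rewrite (divz_eq (C k (2 * b).+1) m) -/c.
  set u := (_ %/ _)%Z; set w := phi _ n.
  clearbody u w c.
  have -> : (u * m%:Z + c) * w + m%:Z * S n - c * w = (u * w + S n) * m%:Z by ring.
  exact: dvdz_mull.
have e3 : (2 * b.+1 = (2 * b).+2)%N by lia.
case=> // j n _; elim: j n => [|j IH] n.
  by rewrite expr1 !muln1 e3 subn1; exact: step.
set N := (3 ^ (2 * b.+1 * j.+1 - 1) * n + k * tri (b.+1 * j.+1))%N.
have -> : (3 ^ (2 * b.+1 * j.+2 - 1) * n + k * tri (b.+1 * j.+2) =
           3 ^ (2 * b).+1 * (3 * N) + k * tri b.+1)%N.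
  have -> : (3 ^ (2 * b.+1 * j.+2 - 1) =
      3 ^ (2 * b).+1 * 3 * 3 ^ (2 * b.+1 * j.+1 - 1))%N.
    by rewrite -expnSr -expnD; congr (3 ^ _)%N; nia.
  rewrite [(b.+1 * j.+2)%N]mulnS triD /N !e3 [(3 ^ (2 * b).+2)%N]expnSr.
  move: (3 ^ (2 * b).+1)%N (3 ^ (_ - 1))%N (tri b.+1) (tri _) => x y t t'.
  by ring.
have PN : phi (euler ^+ (3 * k)) (3 * N)%N = p_coef (3 * k) N.
  by rewrite /phi dvdn_mulr // mulKn // euler_expE.
have := step (3 * N)%N; rewrite PN => S1.
rewrite -(subrKA (c * p_coef (3 * k) N)) exprS -mulrA -mulrBr.
by apply: rpredD S1 _; exact: (dvdz_mull _ (IH n)).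
Qed.

Theorem theorem1p4 (m k : nat) (m_gt1 : (1 < m)%N) (k_bnd : (1 <= k <= 8)%N) :
  ((forall b : nat, (1 <= b)%N -> ~~ (m %| c2 k m_gt1 ^+ b)%Z) ->
   forall b n i : nat, (1 <= b)%N -> (1 <= i <= 2)%N ->
   (m %| p_coef (3 * k)
           (3 ^ (2 * nu k m_gt1 * b) * n
            + ((3 * k + 8 * i) * 3 ^ (2 * nu k m_gt1 * b - 1) - k) %/ 8))%Z)
  /\
  (forall b : nat, (1 <= b)%N -> (m %| c2 k m_gt1 ^+ b)%Z ->
   forall n : nat,
   (m %| p_coef (3 * k)
           (3 ^ (2 * nu k m_gt1 * b - 1) * n
            + (k * (3 ^ (2 * nu k m_gt1 * b) - 1)) %/ 8))%Z).
Proof.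
rewrite /c2 /nu; case: ex_minnP => -[|v] Dv _; first by case/andP: Dv.
have -> : (2 * v.+1 - 1 = (2 * v).+1)%N by lia.
have main := p_coef_modn_iter k_bnd Dv.
have tE j : (8 * tri (v.+1 * j) + 1 = 3 ^ (2 * v.+1 * j))%N.
  by rewrite triE mulnA.
split=> [_ b n i b0 i12 | b b0 cb n].
  (* The index 3n + i is not a multiple of 3, so the series in q^3 has coefficient zero there. *)
  have := main b (3 * n + i)%N b0.
  have -> : phi (euler ^+ (3 * k)) (3 * n + i)%N = 0.
    by rewrite /phi ifF //; lia.
  rewrite mulr0 subr0.
  set N := (_ * _ + _)%N; set N' := (_ + _ %/ 8)%N; suff -> : N' = N by [].
  have := tE b; rewrite /N /N'.
  have -> : (3 ^ (2 * v.+1 * b) = 3 * 3 ^ (2 * v.+1 * b - 1))%N.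
    by rewrite -expnS; congr (3 ^ _)%N; nia.
  move: (3 ^ _)%N (tri _) => e t te.
  (* This follows from 3e = 8t + 1. *)
  have -> : ((3 * k + 8 * i) * e - k = 8 * (k * t + i * e))%N by nia.
  by rewrite mulKn //; ring.
have := main b n b0; set N := (_ * _ + _)%N; set N' := (_ + _ %/ 8)%N.
have -> : N' = N.
  by rewrite /N' /N -tE addnK mulnCA mulKn.
move=> D; rewrite -(subrK ((C k (2 * v).+1 %% m)%Z ^+ b * phi (euler ^+ (3 * k)) n)
  (p_coef _ _)).
by apply: rpredD D _; exact: dvdz_mulr.
Qed.
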